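(* Let $p$ be a prime and let $\mathcal F=\{f_i(x)=(-1)^{a_i}p^{k_i}x+b_i\}_{i=1}^m$ with $b_i\in\mathbb Q$, $a_i\in\{0,1\}$ and $k_i\in\mathbb Z_{>0}$ for $1\le i\le m$. Let $K\subseteq\mathbb Q_p$ be the $p$-adic attractor of $\mathcal F$. Then the $p$-adic box-counting dimension of $K$ exists. Moreover, for every $a\in\mathbb Q$, the $p$-adic box-counting dimension of $\mathcal O^+_{\mathcal F}(a)$ exists, and $$\dim_{\mathrm M}\mathcal O^+_{\mathcal F}(a)=\dim_{\mathrm{Be}}\mathcal O^+_{\mathcal F}(a)=\dim_{\mathrm B,p}\mathcal O^+_{\mathcal F}(a)=\dim_{\mathrm B,p}K=d_{\mathcal F}.$$
   Context: The maps $f_1,\dots,f_m$ are distinct. They are expanding on $\mathbb R$ (or $\mathbb Q$) for the Euclidean metric, and contracting on $\mathbb Q_p$ for the $p$-adic metric $|x-y|_p$ (with $|p|_p=p^{-1}$), with ratios $p^{-k_i}$. The $p$-adic attractor $K$ is the unique nonempty compact set $K\subset\mathbb Q_p$ with $K=\bigcup_{i=1}^mf_i(K)$. $G^*(\mathcal F)$ is the semigroup of distinct maps generated by $\mathcal F$ under composition (all nonempty finite compositions). $\mathcal O^+_{\mathcal F}(a)=\{g(a):g\in G^*(\mathcal F)\}\subset\mathbb Q$ is the forward orbit, viewed both in $\mathbb R$ and in $\mathbb Q_p$. With $|g'|$ the Euclidean absolute value of the linear coefficient of $g$, $d_{\mathcal F}=\lim_{R\to\infty}\log\#\{g\in G^*(\mathcal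 F):|g'|\le R\}/\log R$ (this limit always exists). For $E\subseteq\mathbb R$: $\dim_{\mathrm M}E$ is the common value, when they agree, of the $\liminf$ and $\limsup$ as $h\to\infty$ of $\log\#(E\cap[-h,h])/\log h$; $\dim_{\mathrm{Be}}E=\limsup_{h\to\infty}\sup_{x\in\mathbb R}\log\#(E\cap[x-h,x+h])/\log h$ (Euclidean intervals). For a nonempty bounded set $E\subset\mathbb Q_p$, let $N_r(E)$ be the smallest number of discs of radius $r$ in $\mathbb Q_p$ covering $E$. The upper and lower $p$-adic box-counting dimensions are the $\limsup$ and $\liminf$ as $r\to0^+$ of $\log N_r(E)/(-\log r)$; if they agree the $p$-adic box-counting dimension exists and is denoted $\dim_{\mathrm B,p}E$. *)

(* Defs.v *)
From HB Require Import structures.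
From mathcomp Require Import all_boot all_order all_algebra.
From mathcomp Require Import all_classical all_reals all_analysis.
Import Order.TTheory GRing.Theory Num.Theory.
Import numFieldNormedType.Exports.

Set Implicit Arguments.
Unset Strict Implicit.
Unset Printing Implicit Defensive.

Local Open Scope classical_set_scope.
Local Open Scope ring_scope.

Definition padic_val (p : nat) (x : rat) : int :=
  (logn p `|numq x|%N)%:Z - (logn p `|denq x|%N)%:Z.

Definition padic_abs (R : realType) (p : nat) (x : rat) : R :=
  if x == 0 then 0 else (p%:R : R) ^ (- padic_val p x).

Section PadicAbs.
Variables (R : realType) (p : nat) (hp : prime p).
Implicit Types x y : rat.
Local Notation abs := (padic_abs R p).

Let p_gt0 : (0 : R) < p%:R. Proof. by rewrite ltr0n prime_gt0. Qed.
Let p_gt1 : (1 : R) < p%:R. Proof. by rewrite ltr1n prime_gt1. Qed.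

Lemma padic_val_frac (n d : int) : n != 0 -> d != 0 ->
  padic_val p (n%:~R / d%:~R) = (logn p `|n|%N)%:Z - (logn p `|d|%N)%:Z.
Proof.
move=> n0 d0; set x : rat := _ / _.
have x0 : x != 0 by rewrite mulf_neq0 ?invr_eq0 ?intr_eq0.
have E : numq x * d = n * denq x.
  apply/eqP; rewrite -(eqr_int rat) !intrM numqE.
  by rewrite /x mulrAC divfK ?intr_eq0.
have : logn p (`|numq x| * `|d|) = logn p (`|n| * `|denq x|).
  by rewrite -!abszM E.
have nx0 : numq x != 0 by rewrite numq_eq0.
rewrite !lognM ?absz_gt0 ?denq_neq0// => H.
apply/eqP; rewrite /padic_val subr_eq addrAC eq_sym subr_eq -!PoszD.
by rewrite H addnC.
Qed.

Lemma padic_abs0 : abs 0 = 0. Proof. by rewrite /padic_abs eqxx. Qed.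

Lemma padic_abs_gt0 x : x != 0 -> 0 < abs x.
Proof. by move=> /negPf x0; rewrite /padic_abs x0 exprz_gt0. Qed.

Lemma padic_abs_ge0 x : 0 <= abs x.
Proof.
by have [->|/padic_abs_gt0/ltW//] := eqVneq x 0; rewrite padic_abs0.
Qed.

Lemma padic_abs_eq0 x : (abs x == 0) = (x == 0).
Proof.
by have [->|/padic_abs_gt0/lt0r_neq0/negPf->//] := eqVneq x 0;
  rewrite padic_abs0 eqxx.
Qed.

Lemma padic_abs1 : abs 1 = 1.
Proof. by rewrite /padic_abs oner_eq0 /padic_val (numq_int 1) (denq_int 1) subrr oppr0 expr0z. Qed.

Lemma padic_valM x y : x != 0 -> y != 0 ->
  padic_val p (x * y) = padic_val p x + padic_val p y.
Proof.
move=> x0 y0.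
have -> : x * y = (numq x * numq y)%:~R / (denq x * denq y)%:~R.
  by rewrite -[in LHS](divq_num_den x) -[in LHS](divq_num_den y) mulf_div -!intrM.
rewrite padic_val_frac ?mulf_neq0 ?numq_eq0 ?denq_neq0//.
rewrite !abszM !lognM ?absz_gt0 ?numq_eq0 ?denq_neq0//.
by rewrite /padic_val !PoszD opprD addrACA.
Qed.

Lemma padic_absM x y : abs (x * y) = abs x * abs y.
Proof.
have [->|x0] := eqVneq x 0; first by rewrite mul0r padic_abs0 mul0r.
have [->|y0] := eqVneq y 0; first by rewrite mulr0 padic_abs0 mulr0.
rewrite /padic_abs mulf_eq0 (negPf x0) (negPf y0)/= padic_valM// opprD.
by rewrite expfzDr ?gt_eqF.
Qed.

Lemma padic_absN x : abs (- x) = abs x.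
Proof. by rewrite /padic_abs oppr_eq0 /padic_val numqN denqN abszN. Qed.

Lemma padic_absB x y : abs (x - y) = abs (y - x).
Proof. by rewrite -padic_absN opprB. Qed.

Lemma padic_absV x : abs x^-1 = (abs x)^-1.
Proof.
have [->|x0] := eqVneq x 0; first by rewrite invr0 padic_abs0 invr0.
have ax0 : abs x != 0 by rewrite padic_abs_eq0.
by apply: (mulIf ax0); rewrite -padic_absM !mulVf// padic_abs1.
Qed.

Lemma padic_abs_intle1 (n : int) : abs n%:~R <= 1.
Proof.
rewrite /padic_abs; case: ifPn => // _.
rewrite /padic_val numq_int denq_int logn1 subr0.
rewrite -invr_expz invf_le1 ?exprz_gt0// -exprnP exprn_ege1//.
exact: ltW.
Qed.

Lemma padic_abs_le1D x : abs x <= 1 -> abs (1 + x) <= 1.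
Proof.
have [->|x0] := eqVneq x 0; first by rewrite addr0 padic_abs1.
move=> x1.
suff : coprime p `|denq x|.
  move=> cop; have -> : 1 + x = (denq x + numq x)%:~R / (denq x)%:~R.
    by rewrite intrD mulrDl divff ?intr_eq0 ?denq_neq0// divq_num_den.
  rewrite padic_absM padic_absV [abs (denq x)%:~R]/padic_abs intr_eq0.
  rewrite (negPf (denq_neq0 x)) /padic_val numq_int denq_int logn1 subr0.
  rewrite logn_coprime// expr0z invr1 mulr1.
  exact: padic_abs_intle1.
rewrite prime_coprime//; apply/negP => pd.
move: x1; rewrite /padic_abs (negPf x0) leNgt => /negP; apply.
have -> : padic_val p x = - (logn p `|denq x|%N)%:Z.
  rewrite /padic_val logn_coprime ?sub0r// prime_coprime//.
  apply/negP => pn; have := coprime_num_den x; rewrite /coprime => /eqP cop.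
  have : (p %| gcdn `|numq x| `|denq x|)%N by rewrite dvdn_gcd pn.
  by rewrite cop dvdn1 => /eqP p1; move: hp; rewrite p1.
rewrite opprK exprn_egt1//.
by rewrite -lt0n -pfactor_dvdn ?expn1// absz_gt0 denq_neq0.
Qed.

Lemma padic_abs_ultra x y : abs (x + y) <= Num.max (abs x) (abs y).
Proof.
wlog yx : x y / abs y <= abs x.
  move=> H; have /orP[/H//|/H] := le_total (abs y) (abs x).
  by rewrite [y + x]addrC [in leRHS]maxC.
rewrite (max_idPl yx).
have [x0|x0] := eqVneq x 0.
  by move: yx; rewrite x0 add0r.
have -> : x + y = x * (1 + y / x) by rewrite mulrDr mulr1 mulrC divfK.
rewrite padic_absM ler_piMr ?padic_abs_ge0// padic_abs_le1D//.
by rewrite padic_absM padic_absV ler_pdivrMr ?padic_abs_gt0// mul1r.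
Qed.

Lemma padic_absD x y : abs (x + y) <= abs x + abs y.
Proof.
apply: le_trans (padic_abs_ultra _ _) _.
by rewrite ge_max lerDl lerDr !padic_abs_ge0.
Qed.

Lemma padic_abs_dist x y : `|abs x - abs y| <= abs (x - y).
Proof.
rewrite ler_norml lerNl opprB !lerBlDr; apply/andP; split.
  by rewrite padic_absB -{1}(subrK x y) padic_absD.
by rewrite -{1}(subrK y x) padic_absD.
Qed.

End PadicAbs.

Section CauchySeq.
Variables (R : realType) (p : nat) (hp : prime p).
Local Notation abs := (padic_abs R p).

(* The primality proof is an argument only so that the ring and ideal instances
   below, which rely on it, can be inferred from the types. *)
Definition padic_cauchy of prime p : {pred nat -> rat} := fun x => `[<
  forall e : R, 0 < e ->
    exists N, forall i j, (N <= i)%N -> (N <= j)%N -> abs (x i - x j) < e >].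

Lemma padic_cauchyP (x : nat -> rat) : reflect (forall e : R, 0 < e ->
    exists N, forall i j, (N <= i)%N -> (N <= j)%N -> abs (x i - x j) < e)
  (x \in padic_cauchy hp).
Proof. exact: asboolP. Qed.

Lemma padic_cauchy_bounded x : x \in padic_cauchy hp ->
  exists2 M : R, 0 < M & exists N, forall i, (N <= i)%N -> abs (x i) <= M.
Proof.
move=> /padic_cauchyP /(_ 1 ltr01)[N xN].
exists (abs (x N) + 1); first by rewrite ltr_wpDl ?padic_abs_ge0.
exists N => i Ni; rewrite -(subrK (x N) (x i)).
apply: le_trans (padic_absD _ hp _ _) _.
by rewrite addrC lerD2l ltW// xN.
Qed.

Lemma padic_cauchy_subring : subring_closed (padic_cauchy hp).
Proof.
split=> [|x y cx cy|x y cx cy]; apply/padic_cauchyP.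
- by move=> e e0; exists 0%N => i j _ _; rewrite subrr padic_abs0.
- move=> e e0; have e20 : 0 < e / 2 by rewrite divr_gt0.
  move/padic_cauchyP: cx => /(_ _ e20)[N xN].
  move/padic_cauchyP: cy => /(_ _ e20)[M yM].
  exists (maxn N M) => i j; rewrite !geq_max => /andP[Ni Mi] /andP[Nj Mj].
  have -> : (x - y) i - (x - y) j = (x i - x j) + (y j - y i).
    by rewrite !fctE/= opprB addrACA [in RHS]addrACA [- y i - _]addrC.
  apply: le_lt_trans (padic_absD _ hp _ _) _.
  by rewrite (splitr e) ltrD ?xN ?yM.
- move=> e e0.
  have [A A0 [N0 xA]] := padic_cauchy_bounded cx.
  have [B B0 [M0 yB]] := padic_cauchy_bounded cy.
  have eB0 : 0 < e / 2 / B by rewrite !divr_gt0.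
  have eA0 : 0 < e / 2 / A by rewrite !divr_gt0.
  move/padic_cauchyP: cx => /(_ _ eB0)[N xN].
  move/padic_cauchyP: cy => /(_ _ eA0)[M yM].
  exists (maxn (maxn N0 M0) (maxn N M)) => i j.
  rewrite !geq_max => /andP[/andP[N0i M0i] /andP[Ni Mi]].
  move=> /andP[/andP[N0j M0j] /andP[Nj Mj]].
  have -> : (x * y) i - (x * y) j = (x i - x j) * y i + x j * (y i - y j).
    by rewrite !fctE/= mulrBl mulrBr addrA subrK.
  apply: le_lt_trans (padic_absD _ hp _ _) _.
  rewrite (splitr e) !padic_absM// ltrD//.
    apply: le_lt_trans (_ : _ <= abs (x i - x j) * B) _.
      by rewrite ler_wpM2l ?padic_abs_ge0 ?yB.
    by rewrite -ltr_pdivlMr// xN.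
  apply: le_lt_trans (_ : _ <= A * abs (y i - y j)) _.
    by rewrite ler_wpM2r ?padic_abs_ge0 ?xA.
  by rewrite mulrC -ltr_pdivlMr// yM.
Qed.

HB.instance Definition _ :=
  GRing.isSubringClosed.Build (nat -> rat) (padic_cauchy hp) padic_cauchy_subring.

Record cauchy_seq := CauchySeq { seq_val : nat -> rat ;
  seq_valP : seq_val \in padic_cauchy hp }.

HB.instance Definition _ := [isSub for seq_val].
HB.instance Definition _ := [Choice of cauchy_seq by <:].
HB.instance Definition _ := [SubChoice_isSubComNzRing of cauchy_seq by <:].

Implicit Types x y : cauchy_seq.

Lemma padic_abs_eq u v : abs (u - v) < abs u -> abs v = abs u.
Proof.
move=> uv; apply/le_anti/andP; split.
  rewrite -[v](subKr u) (le_trans (padic_abs_ultra _ hp _ _))// padic_absN.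
  by rewrite ge_max lexx ltW.
rewrite leNgt; apply/negP => vu.
have := padic_abs_ultra R hp (u - v) v.
by rewrite subrK leNgt gt_max uv vu.
Qed.

Definition padic_null : {pred cauchy_seq} := fun x => `[<
  forall e : R, 0 < e ->
    exists N, forall i, (N <= i)%N -> abs (seq_val x i) < e >].

Lemma padic_nullP x : reflect (forall e : R, 0 < e ->
    exists N, forall i, (N <= i)%N -> abs (seq_val x i) < e)
  (x \in padic_null).
Proof. exact: asboolP. Qed.

Lemma padic_null_or x : x \notin padic_null ->
  exists2 c : R, 0 < c & exists N, forall i, (N <= i)%N -> abs (seq_val x i) = c.
Proof.
move=> /padic_nullP/existsNP[e /not_implyP[e0 /forallNP xe]].
have /padic_cauchyP/(_ _ e0)[N xN] := seq_valP x.
have /existsNP[i /not_implyP[Ni /negP]] := xe N; rewrite -leNgt => exi.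
exists (abs (seq_val x i)); first exact: lt_le_trans exi.
by exists N => j Nj; apply: padic_abs_eq; apply: lt_le_trans exi; exact: xN.
Qed.

Lemma padic_null_ideal : idealr_closed padic_null.
Proof.
split.
- by apply/padic_nullP => e e0; exists 0%N => i _; rewrite padic_abs0.
- apply/negP => /padic_nullP /(_ 1 ltr01)[N /(_ N (leqnn N))].
  by rewrite padic_abs1 ltxx.
- move=> a x y /padic_nullP nx /padic_nullP ny; apply/padic_nullP => e e0.
  have [A A0 [N aA]] := padic_cauchy_bounded (seq_valP a).
  have [|N1 xN] := nx (e / A); first by rewrite divr_gt0.
  have [N2 yN] := ny e e0.
  exists (maxn N (maxn N1 N2)) => i; rewrite !geq_max => /and3P[Ni N1i N2i].
  apply: le_lt_trans (padic_abs_ultra _ hp _ _) _.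
  rewrite gt_max yN// andbT padic_absM//.
  apply: le_lt_trans (_ : _ <= A * abs (seq_val x i)) _.
    by rewrite ler_wpM2r ?padic_abs_ge0 ?aA.
  by rewrite mulrC -ltr_pdivlMr// xN.
Qed.

HB.instance Definition _ := isIdealr.Build cauchy_seq padic_null padic_null_ideal.

End CauchySeq.

Section Padic.
Variables (R : realType) (p : nat) (hp : prime p).
Local Notation abs := (padic_abs R p).
Local Notation cauchy_seq := (cauchy_seq R hp).
Local Open Scope quotient_scope.

(* Q_p is the completion of Q for the p-adic absolute value: Cauchy sequences of
   rationals modulo null sequences.  The real type R only serves as the codomain
   of the absolute value and of the metric. *)
Definition padic := {ideal_quot (@padic_null R p hp)}.
HB.instance Definition _ := GRing.ComNzRing.on padic.

Implicit Types (x y : cauchy_seq) (z w : padic).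

Definition padic_pi (x : cauchy_seq) : padic := \pi_padic x.

Lemma padic_piE x y : (padic_pi x == padic_pi y) = (x - y \in @padic_null R p hp).
Proof. by rewrite Quotient.idealrBE. Qed.

Lemma padic_pi_surj z : exists x, z = padic_pi x.
Proof. by exists (repr z); rewrite /padic_pi reprK. Qed.

Lemma padic_piB x y : padic_pi (x - y) = padic_pi x - padic_pi y.
Proof. by rewrite /padic_pi !piE. Qed.

Lemma padic_piD x y : padic_pi (x + y) = padic_pi x + padic_pi y.
Proof. by rewrite /padic_pi !piE. Qed.

Lemma padic_piM x y : padic_pi (x * y) = padic_pi x * padic_pi y.
Proof. by rewrite /padic_pi !piE. Qed.

Lemma padic_pi0 : padic_pi 0 = 0.
Proof. by rewrite /padic_pi !piE. Qed.

Lemma padic_pi1 : padic_pi 1 = 1.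
Proof. by rewrite /padic_pi !piE. Qed.

Lemma padic_pi_eq0 x : (padic_pi x == 0) = (x \in @padic_null R p hp).
Proof. by rewrite -padic_pi0 padic_piE subr0. Qed.

Definition padic_inv z : padic :=
  if z == 0 then 0
  else padic_pi (insubd 0 (fun n => (seq_val (repr z) n)^-1)).

Lemma padic_mulVf z : z != 0 -> padic_inv z * z = 1.
Proof.
move=> z0; rewrite /padic_inv (negPf z0).
have zE : padic_pi (repr z) = z by rewrite /padic_pi reprK.
rewrite -[X in _ * X]zE; set x := repr z in zE *.
have : x \notin @padic_null R p hp by rewrite -padic_pi_eq0 zE.
move=> /padic_null_or[c c0 [N xN]].
have xne0 i : (N <= i)%N -> seq_val x i != 0.
  by move=> Ni; rewrite -(padic_abs_eq0 R hp) xN// gt_eqF.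
have cV : (fun n => (seq_val x n)^-1) \in padic_cauchy R hp.
  apply/padic_cauchyP => e e0.
  have /padic_cauchyP/(_ (e * (c * c)))[|M xM] := seq_valP x.
    by rewrite !mulr_gt0.
  exists (maxn N M) => i j; rewrite !geq_max => /andP[Ni Mi] /andP[Nj Mj].
  have -> : (seq_val x i)^-1 - (seq_val x j)^-1 =
      (seq_val x j - seq_val x i) / (seq_val x i * seq_val x j).
    by rewrite invfM mulrBl [X in _ = X - _]mulrCA divff ?xne0// mulr1 mulVKf ?xne0.
  rewrite padic_absM// padic_absV// padic_absM// !xN// ltr_pdivrMr ?mulr_gt0//.
  exact: xM.
rewrite -padic_piM -padic_pi1; apply/eqP; rewrite padic_piE.
apply/padic_nullP => e e0; exists N => i Ni.
have -> : seq_val (insubd 0 (fun n => (seq_val x n)^-1) * x - 1 : cauchy_seq) i = 0.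
  have /(congr1 (fun f => f i)) := insubdK (0 : cauchy_seq) cV.
  rewrite /= => H; rewrite [LHS](_ : _ = (seq_val x i)^-1 * seq_val x i - 1).
    by rewrite mulVf ?xne0// subrr.
  by rewrite -H.
by rewrite padic_abs0.
Qed.

Lemma padic_inv0 : padic_inv 0 = 0.
Proof. by rewrite /padic_inv eqxx. Qed.

HB.instance Definition _ :=
  GRing.ComNzRing_isField.Build padic padic_mulVf padic_inv0.

Lemma padic_cst_cauchy (a : rat) : (fun=> a) \in padic_cauchy R hp.
Proof.
by apply/padic_cauchyP => e e0; exists 0%N => i j _ _; rewrite subrr padic_abs0.
Qed.

Definition padic_of_rat (a : rat) : padic :=
  padic_pi (CauchySeq (padic_cst_cauchy a)).

Definition padic_norm z : R := limn (fun n => abs (seq_val (repr z) n)).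

Lemma padic_norm_cvg x :
  (abs (seq_val x n) @[n --> \oo]) --> padic_norm (padic_pi x).
Proof.
have cv y : cvgn (fun n => abs (seq_val y n)).
  have [/padic_nullP ny|/padic_null_or[c c0 [N yN]]] :=
    boolP (y \in @padic_null R p hp).
    apply/cvg_ex; exists 0; apply/cvgrPdist_lt => e /ny[N yN].
    exists N => // i /= /yN; rewrite sub0r normrN ger0_norm//.
    exact: padic_abs_ge0.
  apply/cvg_ex; exists c; apply: cvg_near_cst.
  by exists N => // i /= /yN.
set y := repr (padic_pi x).
have /padic_nullP xy : x - y \in @padic_null R p hp.
  by rewrite -padic_piE /y /padic_pi reprK.
have d0 : (abs (seq_val x n) - abs (seq_val y n)) @[n --> \oo] --> (0 : R).
  apply/cvgrPdist_lt => e /xy[N xyN]; exists N => // i /= Ni.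
  rewrite sub0r normrN; apply: (le_lt_trans (padic_abs_dist R hp _ _)).
  exact: xyN.
rewrite -[padic_norm _]addr0.
have -> : (fun n => abs (seq_val x n)) = (fun n => abs (seq_val y n)) +
    (fun n => abs (seq_val x n) - abs (seq_val y n)).
  by apply/funext => n; rewrite !fctE addrC subrK.
exact: (cvgD (cv y) d0).
Qed.

Arguments padic_norm_cvg : clear implicits.

Lemma padic_norm_lim x l : (abs (seq_val x n) @[n --> \oo]) --> l ->
  padic_norm (padic_pi x) = l.
Proof.
move=> h; rewrite -(cvg_lim (@norm_hausdorff _ R) h).
by rewrite (cvg_lim (@norm_hausdorff _ R) (padic_norm_cvg x)).
Qed.

Lemma padic_norm_of_rat a : padic_norm (padic_of_rat a) = abs a.
Proof. by apply: padic_norm_lim; apply: cvg_near_cst; exact: nearW. Qed.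

Lemma padic_norm_ge0 z : 0 <= padic_norm z.
Proof.
have [x ->] := padic_pi_surj z.
apply: (cvgr_to_ge (padic_norm_cvg x)).
by apply: nearW => n; exact: padic_abs_ge0.
Qed.

Lemma padic_norm_eq0 z : (padic_norm z == 0) = (z == 0).
Proof.
have [x ->] := padic_pi_surj z; rewrite padic_pi_eq0.
have [nx|nx] := boolP (x \in @padic_null R p hp).
  move/padic_nullP: nx => nx.
  apply/eqP/padic_norm_lim/cvgrPdist_lt => e /nx[N xN].
  exists N => // i /= Ni; rewrite sub0r normrN ger0_norm ?padic_abs_ge0//.
  exact: xN.
have [c c0 [N xN]] := padic_null_or nx.
rewrite (@padic_norm_lim x c) ?gt_eqF//.
by apply: cvg_near_cst; exists N => // i /= /xN.
Qed.

Lemma padic_normM : {morph padic_norm : z w / z * w}.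
Proof.
move=> z w; have [u ->] := padic_pi_surj z; have [v ->] := padic_pi_surj w.
rewrite -padic_piM; apply: padic_norm_lim.
under eq_cvg do rewrite /= fctE padic_absM//.
exact: cvgM (padic_norm_cvg u) (padic_norm_cvg v).
Qed.

Lemma padic_norm_ultra z w :
  padic_norm (z + w) <= Num.max (padic_norm z) (padic_norm w).
Proof.
have [u ->] := padic_pi_surj z; have [v ->] := padic_pi_surj w.
rewrite -padic_piD maxr_absE.
have cu := padic_norm_cvg u; have cv := padic_norm_cvg v.
have cmax : (fun n => (abs (seq_val u n) + abs (seq_val v n) +
    `|abs (seq_val u n) - abs (seq_val v n)|) / 2) @ \oo -->
    (padic_norm (padic_pi u) + padic_norm (padic_pi v) +
     `|padic_norm (padic_pi u) - padic_norm (padic_pi v)|) / 2.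
  apply: cvgMr_tmp; apply: cvgD; first exact: cvgD.
  by apply: cvg_norm; exact: cvgB.
apply: (ler_cvg_to (padic_norm_cvg (u + v)) cmax).
apply: nearW => n; apply: le_trans (padic_abs_ultra R hp _ _) _.
by rewrite maxr_absE.
Qed.

Lemma padic_normN z : padic_norm (- z) = padic_norm z.
Proof.
have [u ->] := padic_pi_surj z; rewrite -sub0r -padic_pi0 -padic_piB sub0r.
apply: padic_norm_lim; under eq_cvg do rewrite /= fctE padic_absN.
exact: padic_norm_cvg.
Qed.

Lemma padic_of_rat_is_zmod_morphism : zmod_morphism padic_of_rat.
Proof.
move=> a b; rewrite -padic_piB; congr padic_pi; apply: val_inj.
exact/funext.
Qed.

Lemma padic_of_rat_is_monoid_morphism : monoid_morphism padic_of_rat.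
Proof.
split=> [|a b].
  by rewrite -padic_pi1; congr padic_pi; apply: val_inj; exact/funext.
by rewrite -padic_piM; congr padic_pi; apply: val_inj; exact/funext.
Qed.

HB.instance Definition _ := GRing.isZmodMorphism.Build rat padic padic_of_rat
  padic_of_rat_is_zmod_morphism.
HB.instance Definition _ := GRing.isMonoidMorphism.Build rat padic padic_of_rat
  padic_of_rat_is_monoid_morphism.

Definition padic_dist z w : R := padic_norm (z - w).

Lemma padic_distxx z : padic_dist z z = 0.
Proof. by apply/eqP; rewrite /padic_dist subrr padic_norm_eq0. Qed.

Lemma padic_dist_positivity z w : padic_dist z w = 0 -> z = w.
Proof. by move/eqP; rewrite padic_norm_eq0 subr_eq0 => /eqP. Qed.

Lemma padic_dist_sym z w : padic_dist z w = padic_dist w z.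
Proof. by rewrite /padic_dist -padic_normN opprB. Qed.

Lemma padic_dist_ultra w z t :
  padic_dist z t <= Num.max (padic_dist z w) (padic_dist w t).
Proof.
have := padic_norm_ultra (z - w) (w - t).
by rewrite addrA subrK.
Qed.

Lemma padic_dist_triangle w z t :
  padic_dist z t <= padic_dist z w + padic_dist w t.
Proof.
apply: le_trans (padic_dist_ultra w z t) _.
by rewrite ge_max lerDl lerDr !padic_norm_ge0.
Qed.

HB.instance Definition _ := isMetric.Build R padic
  padic_distxx padic_dist_positivity padic_dist_sym padic_dist_triangle.
HB.instance Definition _ := isPointed.Build padic 0.

Lemma padic_ballE z (e : R) : ball z e = [set w | padic_norm (z - w) < e].
Proof. by rewrite ballEmdist. Qed.

Lemma padic_rat_dense z (e : R) : 0 < e -> exists a, ball z e (padic_of_rat a).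
Proof.
move=> e0; have [x ->] := padic_pi_surj z.
have e20 : 0 < e / 2 by rewrite divr_gt0.
have /padic_cauchyP/(_ _ e20)[N xN] := seq_valP x.
exists (seq_val x N); rewrite padic_ballE/= -padic_piB.
apply: (@le_lt_trans _ _ (e / 2)); last by rewrite ltr_pdivrMr// ltr_pMr// ltr1n.
apply: (cvgr_to_le (padic_norm_cvg _)).
by exists N => // i /= Ni; apply/ltW/xN.
Qed.

Lemma padic_complete (F : set_system padic) : ProperFilter F ->
  cauchy F -> cvg F.
Proof.
move=> FF /cauchyP Fc.
have e_gt0 n : 0 < n.+1%:R^-1 :> R by rewrite invr_gt0 ltr0n.
have ball_ultra (z w t : padic) (e : R) : ball z e w -> ball w e t -> ball z e t.
  rewrite !padic_ballE/= => zw wt; apply: le_lt_trans (padic_dist_ultra w z t) _.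
  by rewrite gt_max zw wt.
have /choice[a Fa] n : exists a, F (ball (padic_of_rat a) n.+1%:R^-1).
  have [z Fz] := Fc _ (e_gt0 n); have [a za] := padic_rat_dense z (e_gt0 n).
  exists a; apply: filterS Fz => w zw.
  exact: ball_ultra (ball_sym za) zw.
have aa (n m : nat) : (n <= m)%N -> abs (a n - a m) < n.+1%:R^-1.
  move=> nm; have [w [nw mw]] := filter_ex (filterI (Fa n) (Fa m)).
  have : ball (padic_of_rat (a n)) n.+1%:R^-1 (padic_of_rat (a m)).
    apply: ball_ultra nw _; apply: ball_sym; apply: le_ball mw.
    by rewrite lef_pV2 ?posrE ?ltr0n// ler_nat ltnS.
  by rewrite padic_ballE/= -rmorphB padic_norm_of_rat.
have ca : a \in padic_cauchy R hp.
  apply/padic_cauchyP => e e0; have [N _ Ne] := near_infty_natSinv_lt (PosNum e0).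
  exists N => i j Ni Nj; apply: lt_trans (Ne N (leqnn N)) => /=.
  have -> : a i - a j = (a i - a N) + (a N - a j) by rewrite addrA subrK.
  apply: le_lt_trans (padic_abs_ultra R hp _ _) _.
  by rewrite gt_max padic_absB !aa.
pose L := padic_pi (CauchySeq ca).
apply/cvg_ex; exists L; apply/cvg_ballP => e e0.
have [N _ Ne] := near_infty_natSinv_lt (PosNum e0).
apply: filterS (Fa N) => w aw.
apply: ball_ultra (le_ball (ltW (Ne N (leqnn N))) aw).
rewrite padic_ballE/= -padic_piB.
apply: le_lt_trans (Ne N (leqnn N)) => /=.
apply: (cvgr_to_le (padic_norm_cvg _)).
by exists N => // i /= Ni; rewrite padic_absB ltW// aa.
Qed.

HB.instance Definition _ := Uniform_isComplete.Build padic padic_complete.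

End Padic.

(* Extended-real valued: -oo on the empty set, +oo on infinite sets. *)
Definition log_card (R : realType) (T : choiceType) (E : set T) : \bar R :=
  lne (counting E).

Section IFS.
Variables (R : realType) (I : finType) (f : I -> {poly rat}).

(* Maps are polynomials over Q: polynomials over an infinite field are equal iff
   they define the same function, composition is \Po, the linear coefficient of
   g is g`_1, and g acts on Q_p through map_poly. *)
Inductive ifs_semigroup : set {poly rat} :=
| ifs_semigroup_gen i : ifs_semigroup (f i)
| ifs_semigroup_comp g h :
    ifs_semigroup g -> ifs_semigroup h -> ifs_semigroup (g \Po h).

Definition forward_orbit (x : rat) : set rat := [set g.[x] | g in ifs_semigroup].

Definition growth_rate (r : R) : \bar R :=
  (log_card R [set g | (ifs_semigroup g /\ ratr `|g`_1| <= r)%R] / (ln r)%:E)%E.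

Definition growth_dim : \bar R := lim (growth_rate r @[r --> +oo]).

Definition is_padic_attractor (p : nat) (hp : prime p) (K : set (padic R hp)) :=
  [/\ K !=set0, compact K &
    K = \bigcup_i (horner (map_poly (padic_of_rat R hp) (f i)) @` K)].

End IFS.

Arguments growth_rate R {I} f r.
Arguments growth_dim R {I} f.

Definition power_ifs (p m : nat) (a : 'I_m -> bool) (k : 'I_m -> nat)
    (b : 'I_m -> rat) (i : 'I_m) : {poly rat} :=
  ((-1) ^+ a i * p%:R ^+ k i) *: 'X + (b i)%:P.

Section Dimensions.
Variable R : realType.

Definition mass_rate (E : set R) (h : R) : \bar R :=
  (log_card R (E `&` `[(- h)%R, h]) / (ln h)%:E)%E.

Definition has_mass_dim (E : set R) (d : \bar R) : Prop :=
  limf_einf (mass_rate E) (pinfty_nbhs R) = d /\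
  limf_esup (mass_rate E) (pinfty_nbhs R) = d.

Definition beurling_dim (E : set R) : \bar R :=
  limf_esup (fun h : R => ereal_sup [set
    (log_card R (E `&` `[(x - h)%R, (x + h)%R]) / (ln h)%:E)%E | x in [set: R]])
    (pinfty_nbhs R).

Variables (p : nat) (hp : prime p).
Implicit Type E : set (padic R hp).

Definition padic_disc (c : padic R hp) (r : R) : set (padic R hp) :=
  [set z | padic_norm (z - c) <= r].

(* Equal to +oo when E has no finite cover by discs of radius r, which cannot
   happen for bounded E since closed balls of Q_p are compact. *)
Definition covering_number (r : R) E : \bar R :=
  ereal_inf [set n%:R%:E | n in [set n : nat |
    exists c : 'I_n -> padic R hp, E `<=` \bigcup_i padic_disc (c i) r]].

Definition box_rate E (r : R) : \bar R :=
  (lne (covering_number r E) / (- ln r)%:E)%E.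

Definition has_padic_box_dim E (d : \bar R) : Prop :=
  limf_einf (box_rate E) (0 : R)^'+ = d /\ limf_esup (box_rate E) (0 : R)^'+ = d.

End Dimensions.

(* Main.v *)
Require Import Defs.
From mathcomp Require Import all_boot all_order all_algebra.
From mathcomp Require Import all_classical all_reals all_analysis.
From mathcomp Require Import zify lra.
Import Order.TTheory GRing.Theory Num.Theory.
Import numFieldNormedType.Exports.

Set Implicit Arguments.
Unset Strict Implicit.
Unset Printing Implicit Defensive.

(** Every quantity in the theorem is the exponential growth rate of one counting
function.  A word [w] in the generators gives an affine map
[word_map w = slope w * X + trans w] with [slope w = +-p^(level w)], where
[level w] is the sum of the exponents [k i] along [w].  Let [nmaps n] be the
number of distinct maps given by words of level at most [n].

Cutting a word of level at most [n1 + n2] at the last place where the level is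
still at most [n1] gives [nmaps (n1 + n2) <= (m + 1) * nmaps n1 * nmaps n2]
([nmapsD]), so that [ln (nmaps n) / n] converges to some [L] by Fekete's lemma
([fekete]).  Put [n = scale p h], so that [p^n <= h < p^(n+1)].  A function [Q]
of [h] such that [nmaps n / (c * (n + 1)) <= Q h <= c' * nmaps n] for large [h]
satisfies [ln (Q h) / ln h --> L / ln p] ([cvg_log_count]), and it remains to
give such bounds for each of the counting functions; for the coverings by discs of
radius [r], the scale is [h = 1 / r].

On the real side, every number of the orbit of [x] has the form [z / D], with
[z] an integer and [D] a fixed common denominator.
 - Lower bound ([orbit_count_ge]): a map is determined by its slope and its value
   at [x], and [|g(x)| <= (|x| + sum |b i|) * p^(level g)]; there are only
   [2 * (n + 1)] slopes of level at most [n].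
 - Upper bound ([orbit_count_le]), uniform in the centre of the interval of
   half-length [h]: a point given by a word of level more than [n] is [u(y)],
   with [y = v(x)] for some word [v], and [u] of level between [n] and [n + max k].  As [u]
   expands by at least [p^n], [y] lies in an interval of bounded length, hence
   takes boundedly many values.

On the p-adic side, the same argument serves the orbit and the attractor: let
[S] be a set, and [z] a point whose images by the maps all belong to [S].
 - Lower bound ([covering_number_ge]): if two maps of level at most [n] with
   the same slope send [z] into the same disc of radius at most [p^-n], then their
   integers [D * trans g] agree modulo [p^n].  Since they are [O(p^n)], their quotient by
   [p^n] takes boundedly many values, and the disc, the slope and the quotient
   determine the map.
 - Upper bound ([covering_number_le]): every point of [S] is within
   [C * p^-N] of some [u(z)] with [u] of level at most [N + max k], because a map
   of level [N] contracts p-adic distances by [p^-N] ([padic_orbit_near],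
   [attractor_near]). *)

Local Open Scope classical_set_scope.
Local Open Scope ring_scope.

(** * Subadditive sequences and logarithmic scales *)

Section Subadditive.
Variable R : realType.

Lemma cvg_divn_shift (u : nat -> R) (c l : R) :
  (u n / n%:R @[n --> \oo] --> l) -> ((u n + c) / n%:R @[n --> \oo] --> l).
Proof.
move=> ul; under eq_fun do rewrite mulrDl.
rewrite -[l]addr0; apply: cvgD => //.
rewrite -(mulr0 c); apply: cvgMl_tmp.
rewrite -cvg_shiftS; exact: cvg_harmonic.
Qed.

(** Fekete's lemma with a defect: [u + C] is subadditive, and [u n / n] tends to
the infimum of [(u n + C) / n]. *)
Lemma fekete (u : nat -> R) (C : R) : 0 <= C -> (forall n, 0 <= u n) ->
  (forall m n, u (m + n)%N <= u m + u n + C) ->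
  exists L : R, u n / n%:R @[n --> \oo] --> L.
Proof.
move=> C0 u0 uD; pose v n := u n + C.
have v0 n : 0 <= v n by rewrite addr_ge0.
have vD m n : v (m + n)%N <= v m + v n by rewrite /v; have := uD m n; lra.
have vM N q r : v (q * N + r)%N <= v N * q%:R + v r.
  elim: q => [|q IH]; first by rewrite mul0n add0n mulr0 add0r.
  rewrite mulSn -addnA; apply: le_trans (vD _ _) _.
  by rewrite -natr1 mulrDr mulr1; move: IH; lra.
pose A := [set v n.+1 / n.+1%:R | n in [set: nat]].
have A0 : lbound A 0 by move=> _ [n _ <-]; rewrite divr_ge0.
have hA : has_inf A by split; [exists (v 1%N / 1), 0%N | exists 0].
have LA n : inf A <= v n.+1 / n.+1%:R by apply: ge_inf; [exists 0 | exists n].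
have vL : v n / n%:R @[n --> \oo] --> inf A.
  apply/cvgrPdist_le => e e0; have e20 : 0 < e / 2 by rewrite divr_gt0.
  have [_ [N _ <-] vN] := inf_adherent e20 hA.
  (* [S] bounds all the [v r] for the remainders [r < N + 1]. *)
  pose S := \sum_(r < N.+1) v r.
  near=> n.
  have n0 : (0 < n)%N by near: n; exact: nbhs_infty_gt.
  have nR0 : (0 : R) < n%:R by rewrite ltr0n.
  have Sn : S / (e / 2) <= n%:R by near: n; exact: nbhs_infty_ger.
  have L1 : inf A <= v n / n%:R by rewrite -(prednK n0) LA.
  have vn : v n <= v N.+1 / N.+1%:R * n%:R + S.
    rewrite {1}(divn_eq n N.+1); apply: le_trans (vM _ _ _) _; apply: lerD.
      rewrite -mulrA ler_wpM2l// mulrC ler_pdivlMr ?ltr0n// -natrM ler_nat.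
      exact: leq_divM.
    pose j := Ordinal (ltn_pmod n (ltn0Sn N)).
    by rewrite /S (bigD1 j)//= lerDl sumr_ge0.
  have : v n / n%:R <= v N.+1 / N.+1%:R + e / 2.
    rewrite ler_pdivrMr// mulrDl; apply: le_trans vn _; rewrite lerD2l.
    by rewrite mulrC -ler_pdivrMr.
  move=> vn'; rewrite distrC ger0_norm ?subr_ge0// lerBlDl.
  apply: le_trans vn' _; rewrite [in leRHS](splitr e) addrA lerD2r.
  exact: ltW.
exists (inf A); rewrite (_ : u = fun n => v n + - C).
  exact: cvg_divn_shift.
by apply/funext => n; rewrite /v addrK.
Unshelve. all: by end_near.
Qed.

Lemma cvg_ln_divn : (ln (n.+1%:R : R) / n%:R @[n --> \oo] --> (0 : R)).
Proof.
have h : \forall n \near \oo,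
    0 <= ln (n.+1%:R : R) / n%:R <= 4 * Num.sqrt (harmonic n).
  near=> n.
  have n0 : (0 < n)%N by near: n; exact: nbhs_infty_gt.
  have nR : (1 : R) <= n%:R by rewrite ler1n.
  apply/andP; split; first by rewrite divr_ge0// ln_ge0// ler1n.
  (* Apply [ln s <= s] at the square root [s] of [n + 1]. *)
  pose s := Num.sqrt (n.+1%:R : R).
  have s0 : 0 < s by rewrite sqrtr_gt0 ltr0n.
  have sE : n.+1%:R = s ^+ 2 by rewrite sqr_sqrtr.
  have -> : Num.sqrt (harmonic n) = s^-1 :> R by rewrite /harmonic /= sqrtrV.
  rewrite sE lnXn// ler_pdivrMr ?ltr0n//.
  have ls : ln s <= s by apply/ltW/ln_sublinear.
  have sn : s <= 2 * s^-1 * n%:R.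
    rewrite mulrAC ler_pdivlMr// -expr2 -sE -natr1; lra.
  by rewrite mulr2n; move: ls sn; lra.
apply: (squeeze_cvgr h); first exact: cvg_cst.
rewrite -(mulr0 4); apply: cvgMl_tmp; rewrite -[X in _ --> X]sqrtr0.
apply: continuous_cvg; first exact: sqrt_continuous.
exact: cvg_harmonic.
Unshelve. all: by end_near.
Qed.

End Subadditive.

Lemma exists_expn_ge (R : archiRealFieldType) (p : nat) (C : R) : (1 < p)%N ->
  exists s, C <= p%:R ^+ s.
Proof.
move=> p1; exists (Num.truncn C).+1; apply: (le_trans (ltW (truncnS_gt C))).
by rewrite -natrX ler_nat ltnW// ltn_expl.
Qed.

Section Scale.
Variables (R : realType) (p : nat).
Hypothesis p1 : (1 < p)%N.

(** The exponent of the largest power of [p] not exceeding [h] (for [1 <= h]). *)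
Definition scale (h : R) : nat := trunc_log p (Num.truncn h).

Lemma scale_itv h : 1 <= h -> (p%:R ^+ scale h <= h < p%:R ^+ (scale h).+1).
Proof.
move=> h1; have t0 : (0 < Num.truncn h)%N by rewrite truncn_gt0.
have /andP[a b] := trunc_log_bounds p1 t0.
rewrite -!natrX -truncn_ge_nat ?(le_trans ler01)//.
by rewrite -truncn_lt_nat ?(le_trans ler01)// a b.
Qed.

Lemma scale_le h n : 1 <= h -> (n <= scale h)%N = (p%:R ^+ n <= h).
Proof.
move=> h1; have /andP[a b] := scale_itv h1.
have p1R : (1 : R) < p%:R by rewrite ltr1n.
apply/idP/idP => [ns|ph].
  by apply: le_trans a; rewrite ler_eXn2l.
by rewrite -ltnS -(ltr_eXn2l p1R) (le_lt_trans ph).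
Qed.

Lemma cvg_scale : scale h @[h --> +oo] --> \oo.
Proof.
apply/cvgnyPge => N; near=> h.
rewrite scale_le; last by near: h; exact: nbhs_pinfty_ge.
by near: h; exact: nbhs_pinfty_ge.
Unshelve. all: by end_near.
Qed.

Lemma cvg_scale_ln (u : nat -> R) (L : R) : (u n / n%:R @[n --> \oo] --> L) ->
  u (scale h) / ln h @[h --> +oo] --> L / ln p%:R.
Proof.
move=> uL; have lp : 0 < ln p%:R :> R by rewrite ln_gt0// ltr1n.
have p0 : (0 : R) < p%:R by rewrite ltr0n ltnW.
have c1 : (scale h)%:R / ln h @[h --> +oo] --> (ln p%:R)^-1.
  have h1 : \forall h \near +oo,
     (1 - harmonic (scale h)) / ln p%:R <= (scale h)%:R / ln h <= (ln p%:R)^-1.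
    near=> h.
    have h1 : 1 < h by near: h; exact: nbhs_pinfty_gt.
    have lh : 0 < ln h by rewrite ln_gt0.
    have h0 : 0 < h by apply: lt_trans h1.
    have /andP[a b] := scale_itv (ltW h1).
    have {a} : ln p%:R *+ scale h <= ln h.
      by rewrite -lnXn// ler_ln// posrE// exprn_gt0.
    have {b} : ln h < ln p%:R *+ (scale h).+1.
      by rewrite -lnXn// ltr_ln// posrE// exprn_gt0.
    set n := scale h; rewrite -[ln _ *+ n.+1]mulr_natr -[ln _ *+ n]mulr_natr => b a.
    have n1 : (0 : R) < n.+1%:R by rewrite ltr0n.
    have -> : 1 - harmonic n = n%:R / n.+1%:R :> R.
      apply: (mulIf (lt0r_neq0 n1)).
      by rewrite mulrBl mul1r mulVf ?divfK ?lt0r_neq0// -natr1 addrK.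
    apply/andP; split.
      rewrite -mulrA -invfM ler_wpM2l// lef_pV2 ?posrE ?mulr_gt0//.
      by rewrite mulrC ltW.
    by rewrite ler_pdivrMr// mulrC ler_pdivlMr// mulrC.
  apply: (squeeze_cvgr h1); last exact: cvg_cst.
  rewrite -[X in _ --> X]mul1r; apply: cvgMr_tmp.
  rewrite -[X in _ --> X]subr0; apply: cvgB; first exact: cvg_cst.
  exact: (cvg_comp _ _ cvg_scale cvg_harmonic).
have c2 : u (scale h) / (scale h)%:R @[h --> +oo] --> L.
  exact: (cvg_comp _ _ cvg_scale uL).
apply: cvg_trans (cvgM c2 c1); apply: near_eq_cvg; near=> h.
have n0 : (scale h)%:R != 0 :> R.
  by rewrite pnatr_eq0 -lt0n; near: h; move/cvgnyPgt : cvg_scale; exact.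
by rewrite /= mulrA divfK.
Unshelve. all: by end_near.
Qed.

End Scale.

Lemma cvg_invr_at_right0 (R : realType) : r^-1 @[r --> (0 : R)^'+] --> +oo.
Proof.
apply/cvgryPge => A; near=> r.
have r0 : 0 < r by near: r; exact: nbhs_right_gt.
have A0 : 0 < `|A| + 1 by rewrite ltr_wpDl.
have rA : r <= (`|A| + 1)^-1.
  by near: r; apply: nbhs_right_le; rewrite invr_gt0.
apply: (@le_trans _ _ (`|A| + 1)).
  by rewrite (le_trans (ler_norm A))// lerDl.
by rewrite -[leLHS]invrK lef_pV2 ?posrE ?invr_gt0.
Unshelve. all: by end_near.
Qed.

(** * Upper and lower limits of convergent functions *)

Section Limf.
Variable R : realType.
Local Open Scope ereal_scope.

Lemma cvg_limf_esup (T : choiceType) (X : filteredType T) (F : set_system X)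
    (FF : ProperFilter F) (f : X -> \bar R) (l : R) :
  f @ F --> l%:E -> limf_esup f F = l%:E.
Proof.
move=> /fine_cvgP[ffin fl].
have fe (e : R) : (0 < e)%R -> F [set t | (l - e)%:E <= f t <= (l + e)%:E].
  move=> e0; move/cvgrPdist_le : fl => /(_ _ e0) fl.
  near=> t; have ft : f t \is a fin_num by near: t.
  have : (`|l - fine (f t)| <= e)%R by near: t.
  by rewrite /= -(fineK ft) /= !lee_fin ler_distlC.
rewrite limf_esupE; apply/eqP; rewrite eq_le; apply/andP; split.
  apply/lee_addgt0Pr => e e0; rewrite -EFinD.
  pose V := [set t | (l - e)%:E <= f t <= (l + e)%:E].
  apply: le_trans (_ : ereal_sup [set f t | t in V] <= _).
    by apply: ereal_inf_lbound; exists V => //; exact: fe.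
  by apply: ge_ereal_sup => _ [t /andP[_ ?] <-].
apply: le_ereal_inf_tmp => _ [V FV <-].
apply/lee_addgt0Pr => e e0.
have [t [Vt /andP[le_f _]]] := filter_ex (filterI FV (fe _ e0)).
rewrite -leeBlDr// -EFinB; apply: le_trans le_f _.
by apply: ereal_sup_ubound; exists t.
Unshelve. all: by end_near.
Qed.

Lemma cvg_limf_einf (T : choiceType) (X : filteredType T) (F : set_system X)
    (FF : ProperFilter F) (f : X -> \bar R) (l : R) :
  f @ F --> l%:E -> limf_einf f F = l%:E.
Proof.
move=> fl; rewrite /limf_einf (@cvg_limf_esup _ _ _ _ _ (- l)%R) ?EFinN ?oppeK//.
exact: cvgeN.
Qed.

End Limf.

(** * Words and their affine maps *)

Section Levels.
Variables (m : nat) (k : 'I_m -> nat).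
Implicit Types u v w : seq 'I_m.

(** The sum of the exponents along a word: the map of [w] has linear coefficient
[+-p^(level w)]. *)
Definition level w : nat := (\sum_(i <- w) k i)%N.

Lemma level_cat u v : level (u ++ v) = (level u + level v)%N.
Proof. by rewrite /level big_cat. Qed.

Lemma level_cons i w : level (i :: w) = (k i + level w)%N.
Proof. by rewrite /level big_cons. Qed.

Lemma level_nil : level [::] = 0%N.
Proof. by rewrite /level big_nil. Qed.

Lemma level_seq1 i : level [:: i] = k i.
Proof. by rewrite level_cons level_nil addn0. Qed.

Lemma size_level w : (forall i, (0 < k i)%N) -> (size w <= level w)%N.
Proof.
by move=> k_gt0; elim: w => // i w IH; rewrite level_cons /= -add1n leq_add.
Qed.

(** Either [w] has level at most [n], or there is a letter [i] of [w] at which the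
level of the prefixes of [w] jumps over [n]. *)
Lemma level_split n w : (level w <= n)%N \/
  exists u i v, w = u ++ i :: v /\ (level u <= n < level u + k i)%N.
Proof.
elim: w n => [|i w IH] n; first by left; rewrite level_nil.
have [kn|nk] := leqP (k i) n; last first.
  by right; exists [::], i, w; rewrite level_nil.
have [wn|[u [j [v [-> /andP[un nu]]]]]] := IH (n - k i)%N.
  by left; rewrite level_cons; lia.
by right; exists (i :: u), j, v; rewrite level_cons; split => //; lia.
Qed.

Definition kmax : nat := (\max_i k i)%N.

Lemma level_prefix n w : (level w <= n)%N \/
  exists u v, w = u ++ v /\ (n <= level u <= n + kmax)%N.
Proof.
have [|[u [i [v [-> /andP[un nu]]]]]] := level_split n w; [by left|right].
exists (rcons u i), v; rewrite cat_rcons; split => //.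
rewrite -cats1 level_cat level_seq1.
have : (k i <= kmax)%N by exact: leq_bigmax.
lia.
Qed.

(** A sequence containing all the words of length at most [n]. *)
Fixpoint words n : seq (seq 'I_m) :=
  if n is n'.+1 then [::] :: allpairs cons (enum 'I_m) (words n') else [:: [::]].

Lemma mem_words n w : (size w <= n)%N -> w \in words n.
Proof.
elim: n w => [|n IH] [|i w]; rewrite ?inE// => wn.
by apply/orP; right; apply: allpairs_f; [rewrite mem_enum | exact: IH].
Qed.

End Levels.

Section Words.
Variables (p : nat) (hp : prime p) (m : nat).
Variables (a : 'I_m -> bool) (k : 'I_m -> nat) (b : 'I_m -> rat).
Hypothesis k_gt0 : forall i, (0 < k i)%N.

Local Notation f := (power_ifs p a k b).
Local Notation level := (level k).
Implicit Types (u v w : seq 'I_m) (g : {poly rat}) (x : rat).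

(** The composition of the generators along [w]; the empty word gives the identity
[X]. *)
Definition word_map w : {poly rat} := foldr (fun i g => f i \Po g) 'X w.
(** The parity of the number of orientation-reversing letters. *)
Definition orient w : bool := \big[addb/false]_(i <- w) a i.
Definition slope w : rat := (-1) ^+ orient w * p%:R ^+ level w.
(** The constant coefficient of [word_map w]. *)
Definition trans w : rat := (word_map w).[0].

Let p1 : (1 < p)%N. Proof. exact: prime_gt1. Qed.
Let p0 : (0 : rat) < p%:R. Proof. by rewrite ltr0n ltnW. Qed.

Lemma slope_cons i w : slope (i :: w) = (-1) ^+ a i * p%:R ^+ k i * slope w.
Proof.
rewrite /slope /orient level_cons big_cons signr_addb exprD.
by rewrite mulrACA.
Qed.

Lemma word_map_cat u v : word_map (u ++ v) = word_map u \Po word_map v.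
Proof.
elim: u => [|i u IH] /=; first by rewrite comp_polyX.
by rewrite -comp_polyA -IH.
Qed.

Lemma horner_word_map_cons i w x :
  (word_map (i :: w)).[x] = (-1) ^+ a i * p%:R ^+ k i * (word_map w).[x] + b i.
Proof. by rewrite /= horner_comp /power_ifs hornerD hornerZ hornerX hornerC. Qed.

Lemma slope_nil : slope [::] = 1.
Proof. by rewrite /slope /orient /level !big_nil !expr0 mulr1. Qed.

Lemma horner_word_map w x : (word_map w).[x] = slope w * x + trans w.
Proof.
rewrite /trans; elim: w => [|i w IH].
  by rewrite slope_nil /= !hornerX mul1r addr0.
by rewrite !horner_word_map_cons IH slope_cons mulrDr mulrA addrA.
Qed.

Lemma word_mapE w : word_map w = slope w *: 'X + (trans w)%:P.
Proof.
elim: w => [|i w IH].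
  by rewrite slope_nil /trans /= hornerX addr0 scale1r.
rewrite slope_cons /trans horner_word_map_cons -/(trans w) /= IH /power_ifs.
rewrite comp_polyD comp_polyZ comp_polyX comp_polyC scalerDr scalerA -addrA.
by rewrite polyCD polyCM mul_polyC.
Qed.

Lemma coef1_word_map w : (word_map w)`_1 = slope w.
Proof. by rewrite word_mapE coefD coefZ coefX coefC mulr1 addr0. Qed.

Lemma coef0_word_map w : (word_map w)`_0 = trans w.
Proof. by rewrite word_mapE coefD coefZ coefX coefC mulr0 add0r. Qed.

Lemma normr_slope w : `|slope w| = p%:R ^+ level w.
Proof.
by rewrite /slope normrM normrX normrN1 expr1n mul1r ger0_norm// exprn_ge0// ltW.
Qed.

Lemma slope_neq0 w : slope w != 0.
Proof. by rewrite -normr_eq0 normr_slope expf_neq0 ?gt_eqF. Qed.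

Lemma ifs_semigroupP g : ifs_semigroup f g <-> exists w, w <> [::] /\ g = word_map w.
Proof.
split=> [|[w [w0 ->]]].
  elim=> {g} [i|g h _ [u [u0 ->]] _ [v [v0 ->]]].
    by exists [:: i]; split => //=; rewrite comp_polyXr.
  by exists (u ++ v); rewrite word_map_cat; split => //; case: u u0.
elim: w w0 => // i [|j w] IH _ /=.
  by rewrite comp_polyXr; exact: ifs_semigroup_gen.
by apply: ifs_semigroup_comp; [exact: ifs_semigroup_gen | exact: IH].
Qed.

(** The distinct maps given by words of level at most [n], the identity included. *)
Definition maps n : seq {poly rat} :=
  undup [seq word_map w | w <- [seq w <- words m n | (level w <= n)%N]].

Lemma mapsP n g : reflect (exists2 w, (level w <= n)%N & g = word_map w) (g \in maps n).
Proof.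
rewrite mem_undup; apply: (iffP mapP) => [[w]|[w wn ->]].
  by rewrite mem_filter => /andP[wn _] ->; exists w.
exists w => //; rewrite mem_filter wn mem_words//.
exact: leq_trans (size_level w k_gt0) wn.
Qed.

Lemma uniq_maps n : uniq (maps n). Proof. exact: undup_uniq. Qed.

Definition nmaps n := size (maps n).

Lemma nmaps_gt0 n : (0 < nmaps n)%N.
Proof.
have : 'X \in maps n by apply/mapsP; exists [::]; rewrite // level_nil.
by rewrite /nmaps; case: (maps n).
Qed.

(** A map of level at most [n1 + n2] is a composition [g \Po t \Po h], where [g] has
level at most [n1], [h] has level at most [n2], and [t] is a generator or the
identity. *)
Lemma nmapsD n1 n2 : (nmaps (n1 + n2) <= m.+1 * (nmaps n1 * nmaps n2))%N.
Proof.
pose gens := 'X :: [seq f i | i <- enum 'I_m].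
pose S := allpairs (fun g h => g \Po h) (maps n1)
            (allpairs (fun g h => g \Po h) gens (maps n2)).
have -> : (m.+1 * (nmaps n1 * nmaps n2) = size S)%N.
  by rewrite !size_allpairs /= size_map size_enum_ord -/(nmaps _) -/(nmaps n2); lia.
apply: uniq_leq_size (uniq_maps _) _ => _ /mapsP[w wn ->].
have [w1|[u [i [v [wE /andP[un nu]]]]]] := level_split k n1 w.
  have <- : word_map w \Po ('X \Po 'X) = word_map w by rewrite !comp_polyXr.
  apply: allpairs_f; first by apply/mapsP; exists w.
  apply: allpairs_f; first by rewrite inE eqxx.
  by apply/mapsP; exists [::]; rewrite // level_nil.
rewrite wE word_map_cat /=; apply: allpairs_f; first by apply/mapsP; exists u.
apply: allpairs_f; first by rewrite inE map_f ?mem_enum ?orbT.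
apply/mapsP; exists v => //.
by move: wn; rewrite wE level_cat level_cons; lia.
Qed.

Lemma nmaps_shift s : exists2 c, (0 < c)%N & forall n, (nmaps (n + s) <= c * nmaps n)%N.
Proof.
exists (m.+1 * nmaps s)%N => [|n]; first by rewrite muln_gt0 nmaps_gt0.
by apply: leq_trans (nmapsD _ _) _; rewrite mulnA mulnAC.
Qed.

(** The elements of the semigroup of level at most [n]: since all the [k i] are
positive, only the empty word gives the identity. *)
Definition nid_maps n := [seq g <- maps n | g != 'X].

Lemma nid_mapsP n g :
  reflect (exists w, [/\ w <> [::], (level w <= n)%N & g = word_map w])
          (g \in nid_maps n).
Proof.
rewrite mem_filter; apply: (iffP andP) => [[gX /mapsP[w wn gE]]|[w [w0 wn ->]]].
  by exists w; split => // w0; move: gX; rewrite gE w0 eqxx.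
split; last by apply/mapsP; exists w.
apply: contra_notN w0 => /eqP wX.
have := normr_slope w; rewrite -coef1_word_map wX coefX normr1 => /esym/eqP.
rewrite pexprn_eq1 ?ltW// (gt_eqF _ : p%:R == 1 = false) ?ltr1n// orbF => /eqP l0.
by have := size_level w k_gt0; rewrite l0 leqn0 => /nilP.
Qed.

Lemma nmaps_nid n : (nmaps n <= (size (nid_maps n)).+1)%N.
Proof.
have -> : (size (nid_maps n)).+1 = size ('X :: nid_maps n) by [].
apply: uniq_leq_size (uniq_maps n) _ => g gn.
by rewrite inE mem_filter gn andbT orbN.
Qed.

Lemma nmaps_le2nid : (0 < m)%N -> \forall n \near \oo,
  (nmaps n <= 2 * size (nid_maps n))%N.
Proof.
move=> m0; exists (k (Ordinal m0)) => // n /= kn.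
have : f (Ordinal m0) \in nid_maps n.
  apply/nid_mapsP; exists [:: Ordinal m0]; split => //; last by rewrite /= comp_polyXr.
  by rewrite level_seq1.
move=> fn; have s0 : (0 < size (nid_maps n))%N by case: (nid_maps n) fn.
by apply: leq_trans (nmaps_nid n) _; rewrite mul2n -addnn -addn1 leq_add2l.
Qed.

(** A bound of all the [|b i|]. *)
Definition bsum : rat := \sum_i `|b i|.

(** [|trans w|] is at most a constant times the linear coefficient. *)
Lemma normr_trans w : `|trans w| <= bsum * p%:R ^+ level w.
Proof.
(* The bound that goes through the induction; it uses [p ^ k i >= 2]. *)
suff : `|trans w| <= bsum * (p%:R ^+ level w - 1).
  move=> h; apply: le_trans h _; rewrite ler_wpM2l ?sumr_ge0//.
  by rewrite gerBl.
elim: w => [|i w IH].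
  by rewrite /trans /= hornerX normr0 /level big_nil subrr mulr0.
have bi : `|b i| <= bsum by rewrite /bsum (bigD1 i)//= lerDl sumr_ge0.
rewrite /trans horner_word_map_cons -/(trans w) level_cons exprD.
have P2 : 2 <= p%:R ^+ k i :> rat.
  rewrite -natrX ler_nat -(prednK (k_gt0 i)) expnS.
  by rewrite (leq_trans p1)// leq_pmulr// expn_gt0 ltnW.
apply: le_trans (ler_normD _ _) _; rewrite !normrM !normrX normrN1 expr1n mul1r.
rewrite (ger0_norm (ltW p0)).
set P := p%:R ^+ k i in P2 *; set Q := p%:R ^+ level w in IH *.
have PQ : P * `|trans w| <= P * (bsum * (Q - 1)) by rewrite ler_wpM2l// (le_trans _ P2).
have b0 : 0 <= bsum by rewrite sumr_ge0.
by nra.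
Qed.

Lemma common_denominator x : exists2 D : nat, (0 < D)%N &
  D%:R * x \is a Num.int /\ forall i, D%:R * b i \is a Num.int.
Proof.
have denqE (y : rat) : (`|denq y|%N)%:R * y \is a Num.int.
  by rewrite natr_absz ger0_norm ?denq_ge0// mulrC -numqE rpred_int.
exists (`|denq x| * \prod_i `|denq (b i)|)%N.
  rewrite muln_gt0 absz_gt0 denq_neq0 /= prodn_gt0// => i.
  by rewrite absz_gt0 denq_neq0.
split=> [|i].
  by rewrite mulnC natrM -mulrA rpredM ?natr_int.
by rewrite (bigD1 i)//= mulnCA natrM -mulrA mulrCA rpredM// natr_int.
Qed.

Lemma int_word_map (D : nat) x w : D%:R * x \is a Num.int ->
  (forall i, D%:R * b i \is a Num.int) -> D%:R * (word_map w).[x] \is a Num.int.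
Proof.
move=> Dx Db; elim: w => [|i w IH]; first by rewrite /= hornerX.
rewrite horner_word_map_cons mulrDr mulrCA rpredD// rpredM//.
by rewrite rpredM// rpredX ?rpredN ?rpred1 ?natr_int.
Qed.

End Words.

(** * Logarithmic counting functions *)

Section LogRatio.
Variable R : realType.
Local Open Scope ereal_scope.

Lemma lne_ratio_ge (v h : R) (x : \bar R) : (0 < v)%R -> (1 < h)%R -> v%:E <= x ->
  (ln v / ln h)%:E <= lne x / (ln h)%:E.
Proof.
move=> v0 h1 vx; have lh : (0 < ln h)%R by rewrite ln_gt0.
rewrite EFinM inver gt_eqF// lee_pmul2r ?lte_fin ?invr_gt0//.
rewrite -lne_EFin// lee_lne// in_itv /= ?leey ?andbT ?lee_fin ?ltW//.
by apply: lt_le_trans vx; rewrite lte_fin.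
Qed.

Lemma lne_ratio_le (v h : R) (x : \bar R) : (0 < v)%R -> (1 < h)%R -> 0 <= x ->
  x <= v%:E -> lne x / (ln h)%:E <= (ln v / ln h)%:E.
Proof.
move=> v0 h1 x0 vx; have lh : (0 < ln h)%R by rewrite ln_gt0.
rewrite EFinM inver gt_eqF// lee_pmul2r ?lte_fin ?invr_gt0//.
by rewrite -lne_EFin// lee_lne// in_itv /= leey andbT// lee_fin ltW.
Qed.

End LogRatio.

Section CountingBounds.
Variable R : realType.
Local Open Scope ereal_scope.

Lemma counting_le_size (T : choiceType) (E : set T) (s : seq T) :
  (forall x, E x -> x \in s) -> counting E <= (size s)%:R%:E :> \bar R.
Proof.
move=> Es; have fE : finite_set E by apply: (sub_finite_set _ (finite_seq s)).
rewrite /counting asboolT// lee_fin ler_nat; apply: uniq_leq_size => // x.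
by rewrite in_fset_set// inE => /Es.
Qed.

(** To bound the cardinality of [E] from below it is enough to bound from below
the length of every sequence that contains [E]; this covers infinite [E] too. *)
Lemma counting_ge_size (T : choiceType) (E : set T) (N c : nat) : (0 < c)%N ->
  (forall s, (forall x, E x -> x \in s) -> (N <= c * size s)%N) ->
  (N%:R / c%:R)%:E <= counting E :> \bar R.
Proof.
move=> c0 H; rewrite /counting; case: asboolP => [fE|_]; last by rewrite leey.
rewrite lee_fin ler_pdivrMr ?ltr0n// mulrC -natrM ler_nat H// => x Ex.
by rewrite in_fset_set// inE.
Qed.

Lemma counting_seq (T : choiceType) (s : seq T) : uniq s ->
  counting [set` s] = (size s)%:R%:E :> \bar R.
Proof.
move=> us; apply/eqP; rewrite eq_le counting_le_size//=.
have := @counting_ge_size T [set` s] (size s) 1 isT; rewrite divr1; apply => t st.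
by rewrite mul1n uniq_leq_size.
Qed.

End CountingBounds.

(** In this section [M] is a counting function with [ln (M n) / n --> L], to which
other counting functions of a real scale [h] are compared. *)
Section Growth.
Variables (R : realType) (p : nat) (M : nat -> nat) (L : R).
Hypothesis p1 : (1 < p)%N.
Hypothesis M0 : forall n, (0 < M n)%N.
Hypothesis ML : ln (M n)%:R / n%:R @[n --> \oo] --> L.

(** The factor [n + 1], with [n = scale p h], allows for the number of levels up to
[n]; it does not change the growth rate. *)
Definition lower_count (c : nat) (h : R) : R :=
  (M (scale p h))%:R / (c * (scale p h).+1)%:R.

Definition upper_count (c : nat) (h : R) : R := (c * M (scale p h))%:R.

Lemma lower_count_gt0 c h : (0 < c)%N -> 0 < lower_count c h.
Proof. by move=> c0; rewrite divr_gt0// ltr0n ?muln_gt0 ?c0. Qed.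

Lemma upper_count_gt0 c h : (0 < c)%N -> 0 < upper_count c h.
Proof. by move=> c0; rewrite ltr0n muln_gt0 c0 M0. Qed.

Lemma cvg_lower_count c : (0 < c)%N ->
  ln (lower_count c h) / ln h @[h --> +oo] --> L / ln p%:R.
Proof.
move=> c0.
pose u n : R := ln (M n)%:R - ln n.+1%:R + - ln c%:R.
have -> : (fun h => ln (lower_count c h) / ln h) = (fun h => u (scale p h) / ln h).
  apply/funext => h; congr (_ / _).
  rewrite /lower_count /u ln_div ?posrE ?ltr0n ?muln_gt0 ?c0// natrM.
  by rewrite lnM ?posrE ?ltr0n// opprD addrA addrAC.
apply: cvg_scale_ln => //; apply: cvg_divn_shift.
under eq_fun do rewrite mulrBl.
by rewrite -[L]subr0; apply: cvgB => //; exact: cvg_ln_divn.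
Qed.

Lemma cvg_upper_count c : (0 < c)%N ->
  ln (upper_count c h) / ln h @[h --> +oo] --> L / ln p%:R.
Proof.
move=> c0.
pose u n : R := ln (M n)%:R + ln c%:R.
have -> : (fun h => ln (upper_count c h) / ln h) = (fun h => u (scale p h) / ln h).
  apply/funext => h; congr (_ / _).
  by rewrite /upper_count /u natrM lnM ?posrE ?ltr0n// addrC.
by apply: cvg_scale_ln => //; exact: cvg_divn_shift.
Qed.

Lemma cvg_log_count (T : Type) (F : set_system T) (FF : Filter F)
    (h : T -> R) (Q : T -> \bar R) (c c' : nat) : (0 < c)%N -> (0 < c')%N ->
    h @ F --> +oo ->
    (\forall t \near F, ((ln (lower_count c (h t)) / ln (h t))%:E <= Q t
                      <= (ln (upper_count c' (h t)) / ln (h t))%:E)%E) ->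
  Q @ F --> (L / ln p%:R)%:E.
Proof.
move=> c0 c0' hF HQ; apply: (squeeze_cvge HQ).
  by apply: cvg_EFin; [exact: nearW | exact: (cvg_comp _ _ hF (cvg_lower_count c0))].
by apply: cvg_EFin; [exact: nearW | exact: (cvg_comp _ _ hF (cvg_upper_count c0'))].
Qed.

End Growth.

(** * Growth rate and real dimensions *)

Section RealDimensions.
Variables (R : realType) (p : nat) (hp : prime p) (m : nat) (m_gt0 : (0 < m)%N).
Variables (a : 'I_m -> bool) (k : 'I_m -> nat) (b : 'I_m -> rat).
Hypothesis k_gt0 : forall i, (0 < k i)%N.

Local Notation f := (power_ifs p a k b).
Local Notation maps := (maps p a k b).
Local Notation nmaps := (nmaps p a k b).
Local Notation nid_maps := (nid_maps p a k b).
Local Notation word_map := (word_map p a k b).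
Local Notation slope := (slope p a k).
Local Notation trans := (trans p a k b).
Local Notation level := (level k).

Let p1 : (1 < p)%N. Proof. exact: prime_gt1. Qed.
Let p1R : (1 : R) < p%:R. Proof. by rewrite ltr1n. Qed.
Let p0R : (0 : R) < p%:R. Proof. by rewrite ltr0n ltnW. Qed.

Lemma cvg_ln_nmaps : exists L : R, ln (nmaps n)%:R / n%:R @[n --> \oo] --> L.
Proof.
apply: (@fekete _ _ (ln m.+1%:R)).
- by rewrite ln_ge0// ler1n.
- by move=> n; rewrite ln_ge0// ler1n nmaps_gt0.
move=> n1 n2; have M0 n : (0 < nmaps n)%N by exact: nmaps_gt0.
rewrite addrC -!lnM ?posrE ?mulr_gt0 ?ltr0n// -!natrM.
by rewrite ler_ln ?posrE ?ltr0n ?muln_gt0 ?M0// ler_nat nmapsD.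
Qed.

(** The possible linear coefficients of the maps of level at most [n]. *)
Definition slopes n : seq rat :=
  [seq (-1) ^+ nat_of_bool s * p%:R ^+ l | s <- [:: true; false], l <- iota 0 n.+1].

Lemma size_slopes n : size (slopes n) = (2 * n.+1)%N.
Proof. by rewrite size_allpairs size_iota. Qed.

Lemma mem_slopes n w : (level w <= n)%N -> slope w \in slopes n.
Proof.
move=> wn; apply/allpairsP; exists (orient a w, level w); split => //=.
  by case: (orient a w).
by rewrite (mem_iota 0 n.+1).
Qed.

Lemma nid_maps_eq (g h : {poly rat}) n n' (x : rat) :
  g \in nid_maps n -> h \in nid_maps n' -> g`_1 = h`_1 -> g.[x] = h.[x] -> g = h.
Proof.
move=> /(nid_mapsP hp _ _ k_gt0)[u [_ _ ->]] /(nid_mapsP hp _ _ k_gt0)[v [_ _ ->]].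
rewrite !coef1_word_map !horner_word_map => suv; rewrite suv => /addrI tuv.
by rewrite !word_mapE suv tuv.
Qed.

Lemma forward_orbit_nid n x g : g \in nid_maps n ->
  forward_orbit f x g.[x].
Proof.
move=> /(nid_mapsP hp _ _ k_gt0)[w [w0 _ ->]].
by exists (word_map w) => //; apply/ifs_semigroupP; exists w.
Qed.

Variable L : R.
Hypothesis HL : ln (nmaps n)%:R / n%:R @[n --> \oo] --> L.

Let d : R := L / ln p%:R.
Let M0 n : (0 < nmaps n)%N. Proof. exact: nmaps_gt0. Qed.

Lemma cvg_growth_rate : growth_rate R f r @[r --> +oo] --> d%:E.
Proof.
apply: (@cvg_log_count _ p nmaps L p1 M0 HL _ _ _ id _ 2 1) => //.
near=> r; have r1 : 1 < r by near: r; exact: nbhs_pinfty_gt.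
set n := scale p r.
have nE : [set g | ifs_semigroup f g /\ ratr `|g`_1| <= r] = [set` nid_maps n].
  apply/seteqP; split => g /=.
    move=> [/ifs_semigroupP[w [w0 ->]]].
    rewrite coef1_word_map normr_slope rmorphXn /= ratr_nat => wr.
    by apply/(nid_mapsP hp _ _ k_gt0); exists w; split => //; rewrite scale_le// ltW.
  move=> /(nid_mapsP hp _ _ k_gt0)[w [w0 wn ->]]; split.
    by apply/ifs_semigroupP; exists w.
  rewrite coef1_word_map normr_slope rmorphXn /= ratr_nat.
  by rewrite -scale_le// ltW.
have un : uniq (nid_maps n) by rewrite filter_uniq// uniq_maps.
have M2 : (nmaps n <= 2 * size (nid_maps n))%N.
  rewrite /n; near: r.
  exact: (@cvg_scale R p p1 _ (nmaps_le2nid hp a b k_gt0 m_gt0)).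
rewrite /growth_rate /log_card nE counting_seq//; apply/andP; split.
  apply: lne_ratio_ge => //; first exact: lower_count_gt0.
  rewrite lee_fin ler_pdivrMr ?ltr0n// -natrM ler_nat -/n.
  by apply: leq_trans M2 _; rewrite mulnCA leq_mul2l leq_pmulr// orbT.
apply: lne_ratio_le => //; first exact: upper_count_gt0.
by rewrite lee_fin ler_nat mul1n size_filter count_size.
Unshelve. all: by end_near.
Qed.

Lemma growth_dimE : growth_dim R f = d%:E.
Proof. exact: (cvg_lim _ cvg_growth_rate). Qed.

Variable x : rat.
Local Notation E := ((@ratr R) @` forward_orbit f x).

(** For large [h], at least [nmaps n / (c * (n + 1))] points of the orbit belong to
the interval [[-h, h]], where [n = scale p h]. *)
Lemma orbit_count_ge : exists2 c, (0 < c)%N & \forall h \near +oo,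
  ((lower_count p nmaps c h)%:E <= counting (E `&` `[(- h)%R, h]) :> \bar R)%E.
Proof.
pose C := `|x| + bsum b.
(* Maps of level at most [n - s] send [x] into the interval [[-p^n, p^n]]. *)
have [s Cs] := exists_expn_ge C p1.
have [c c0 Mc] := nmaps_shift hp a b k_gt0 s.
exists (4 * c)%N; first by rewrite muln_gt0.
near=> h; have h1 : 1 < h by near: h; exact: nbhs_pinfty_gt.
rewrite /lower_count; set n := scale p h.
have sn : (s <= n)%N by rewrite scale_le// ?ltW//; near: h; exact: nbhs_pinfty_ge.
have M2 : (nmaps (n - s) <= 2 * size (nid_maps (n - s)))%N.
  rewrite /n; near: h.
  apply: (@cvg_scale R p p1 (fun i => (nmaps (i - s) <= 2 * size (nid_maps (i - s)))%N)).
  have [N _ HN] := nmaps_le2nid hp a b k_gt0 m_gt0.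
  exists (N + s)%N => // i /= Ni; apply: HN => /=; lia.
apply: counting_ge_size => [|t Et]; first by rewrite !muln_gt0 c0.
apply: (@leq_trans (c * nmaps (n - s))%N); first by rewrite -{1}(subnK sn).
have szt : (size (nid_maps (n - s)) <= size t * (2 * n.+1))%N.
  (* A map is determined by its value at [x] and its slope. *)
  pose key (g : {poly rat}) : R * rat := (ratr g.[x], g`_1).
  rewrite -(size_map key) -size_slopes -(@size_allpairs _ _ _ pair).
  apply: uniq_leq_size => [|_ /mapP[g gn ->]].
    rewrite map_inj_in_uniq ?filter_uniq ?uniq_maps// => g g' gn gn' [e1 e2].
    by apply: (nid_maps_eq gn gn' e2); exact: (fmorph_inj _ e1).
  have /(nid_mapsP hp _ _ k_gt0)[w [w0 wn gE]] := gn.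
  apply: allpairs_f; last first.
    by rewrite gE coef1_word_map mem_slopes// (leq_trans wn)// leq_subr.
  apply: Et; split.
    by exists g.[x] => //; exact: forward_orbit_nid gn.
  have gx : `|g.[x]| <= p%:R ^+ n.
    rewrite gE horner_word_map; apply: le_trans (ler_normD _ _) _.
    rewrite normrM normr_slope.
    have := normr_trans hp a b k_gt0 w.
    have : p%:R ^+ level w <= p%:R ^+ (n - s) :> rat.
      by rewrite ler_eXn2l// ltr1n.
    rewrite -[in X in _ -> _ -> _ <= X](subnK sn) exprD.
    have : 0 <= `|x| + bsum b by rewrite addr_ge0// sumr_ge0.
    have : 0 <= p%:R ^+ (n - s) :> rat by rewrite exprn_ge0.
    have := Cs; rewrite /C; set P := p%:R ^+ (n - s); set Q := p%:R ^+ level w.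
    set S := p%:R ^+ s; set X := `|x|; set B := bsum b => CS P0 XB0 QP tB.
    have : (X + B) * Q <= S * P.
      apply: (@le_trans _ _ ((X + B) * P)); first exact: ler_wpM2l.
      exact: ler_wpM2r.
    by rewrite mulrDl [P * S]mulrC [Q * X]mulrC; move: tB; lra.
  rewrite /= in_itv /= -ler_norml -ratr_norm.
  have /andP[ph _] := scale_itv p1 (ltW h1).
  apply: le_trans ph; rewrite -/n -(ratr_nat R p) -rmorphXn /=.
  by rewrite ler_rat.
have -> : (4 * c * n.+1 * size t = c * (2 * (size t * (2 * n.+1))))%N by lia.
by rewrite leq_mul2l (leq_trans M2) ?orbT// leq_mul2l szt orbT.
Unshelve. all: by end_near.
Qed.

(** For [h > 1] and [n = scale p h], at most [c * nmaps n] points of the orbit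
belong to an interval of half-length [h], wherever its centre is. *)
Lemma orbit_count_le : exists2 c, (0 < c)%N & forall X h : R, 1 < h ->
  (counting (E `&` `[(X - h)%R, (X + h)%R]) <= (upper_count p nmaps c h)%:E :> \bar R)%E.
Proof.
have [D D0 [Dx Db]] := common_denominator b x.
have [c c0 Mc] := nmaps_shift hp a b k_gt0 (kmax k).
exists (c * (2 * D * p + 4))%N => [|X h h1].
  by rewrite muln_gt0 c0 addn_gt0 orbT.
set n := scale p h.
have D0R : (0 : R) < D%:R by rewrite ltr0n.
(* If [g.[y]] is in the interval with centre [X] and half-length [h], where
   [y = z / D] and [g] has level at least [n], then the integer [z] lies between
   [T g] and [T g + 2 * D * p + 1].  The index [0] of [F g] is kept for the points
   given by words of level at most [n]. *)
pose T (g : {poly rat}) : int :=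
  Num.floor (D%:R * ((X - ratr g`_0) / ratr g`_1) - D%:R * p%:R).
pose F g (j : nat) : rat := if j is j'.+1 then (T g + j'%:Z)%:~R / D%:R else x.
pose t := [seq ratr (g.[F g j]) : R |
  g <- maps (n + kmax k), j <- iota 0 (2 * D * p + 4)].
apply: (@le_trans _ _ (size t)%:R%:E); last first.
  rewrite lee_fin ler_nat size_allpairs size_iota.
  by set J := (_ + 4)%N; rewrite mulnAC leq_mul2r Mc orbT.
apply: counting_le_size => _ [[_ [_ /ifs_semigroupP[w [w0 ->]] <-] <-]].
rewrite /= in_itv /= => wX.
have [wn|[u [v [wE /andP[nu un]]]]] := level_prefix k n w.
  apply/allpairsP; exists (word_map w, 0%N); split => //=.
    by apply/(mapsP p a b k_gt0); exists w => //; lia.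
  by rewrite mem_iota; lia.
have /intrP[z zE] := int_word_map p a k v Dx Db.
set y := (word_map v).[x] in zE.
have yE : y = z%:~R / D%:R by rewrite -zE mulrC mulKf// pnatr_eq0 -lt0n.
have wy : (word_map w).[x] = slope u * y + trans u.
  by rewrite wE word_map_cat horner_comp -horner_word_map.
have Tz : (T (word_map u) <= z)%R /\ (z - T (word_map u) < 2 * D%:Z * p%:Z + 3)%R.
  have g1 : slope u != 0 by exact: slope_neq0.
  set P : R := p%:R ^+ level u.
  have P0 : 0 < P by rewrite exprn_gt0.
  have nP : `|ratr (slope u) : R| = P.
    by rewrite -ratr_norm normr_slope rmorphXn /= ratr_nat.
  have hP : h <= P * p%:R.
    have /andP[_ hp1] := scale_itv p1 (ltW h1).
    by rewrite (le_trans (ltW hp1))// -exprSr ler_eXn2l.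
  pose c0' : R := (X - ratr (trans u)) / ratr (slope u).
  have yc : `|ratr y - c0'| <= p%:R.
    rewrite -(ler_pM2l P0); apply: le_trans hP.
    have sc : ratr (slope u) * c0' = X - ratr (trans u).
      by rewrite /c0' mulrC divfK ?fmorph_eq0.
    rewrite -nP -normrM mulrBr sc opprB addrA -rmorphM -rmorphD -wy.
    by rewrite ler_distl.
  have zc : `|z%:~R - D%:R * c0'| <= D%:R * p%:R.
    have -> : z%:~R = D%:R * ratr y :> R.
      by rewrite -(ratr_int R) -zE rmorphM /= ratr_nat.
    by rewrite -mulrBr normrM ger0_norm ?ler_pM2l// ltW.
  rewrite /T coef0_word_map coef1_word_map -/c0'.
  have := floor_itv (D%:R * c0' - D%:R * p%:R).
  set t0 := Num.floor _; rewrite intrD => /andP[t1 t2].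
  move: zc; rewrite ler_distl => /andP[z1 z2].
  split; first by rewrite -(ler_int R) (le_trans t1)//.
  rewrite -(ltr_int R) intrB intrD !intrM /=; move: t2 z2; lra.
apply/allpairsP; exists (word_map u, `|z - T (word_map u)|%N.+1); split => /=.
- by apply/(mapsP p a b k_gt0); exists u.
- rewrite mem_iota; lia.
- rewrite gez0_abs ?subr_ge0; last by lia.
  by rewrite [T _ + _]addrC subrK -yE wy -horner_word_map.
Qed.

Lemma mass_rate_bounds : exists c c', [/\ (0 < c)%N, (0 < c')%N &
  \forall h \near +oo, ((ln (lower_count p nmaps c h) / ln h)%:E <= mass_rate E h
                      <= (ln (upper_count p nmaps c' h) / ln h)%:E)%E].
Proof.
have [c c0 lo] := orbit_count_ge; have [c' c0' up] := orbit_count_le.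
exists c, c'; split => //; near=> h; have h1 : 1 < h by near: h; exact: nbhs_pinfty_gt.
apply/andP; split.
  by apply: lne_ratio_ge => //; [exact: lower_count_gt0|near: h].
apply: lne_ratio_le => //; first exact: upper_count_gt0.
by have := up 0 h h1; rewrite sub0r add0r.
Unshelve. all: by end_near.
Qed.

Lemma has_mass_dim_orbit : has_mass_dim E d%:E.
Proof.
have [c [c' [c0 c0' H]]] := mass_rate_bounds.
have cv : mass_rate E h @[h --> +oo] --> d%:E.
  exact: (@cvg_log_count _ p nmaps L p1 M0 HL _ _ _ id _ c c').
by split; [exact: cvg_limf_einf | exact: cvg_limf_esup].
Qed.

Lemma beurling_dim_orbit : beurling_dim E = d%:E.
Proof.
have [c [c2 [c0 _ H]]] := mass_rate_bounds; have [c' c0' up] := orbit_count_le.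
apply: cvg_limf_esup.
apply: (@cvg_log_count _ p nmaps L p1 M0 HL _ _ _ id _ c c') => //.
near=> h; have h1 : 1 < h by near: h; exact: nbhs_pinfty_gt.
apply/andP; split.
  apply: (@le_trans _ _ (mass_rate E h)).
    have /andP[] : ((ln (lower_count p nmaps c h) / ln h)%:E <= mass_rate E h
       <= (ln (upper_count p nmaps c2 h) / ln h)%:E)%E by near: h.
    by [].
  by apply: ereal_sup_ubound; exists 0; rewrite // sub0r add0r.
apply: ge_ereal_sup => _ [X _ <-].
apply: lne_ratio_le => //; first exact: upper_count_gt0.
exact: up.
Unshelve. all: by end_near.
Qed.

End RealDimensions.

(** * p-adic box dimensions *)

Section PadicDimensions.
Variables (R : realType) (p : nat) (hp : prime p).
Local Notation inQp := (padic_of_rat R hp).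
Local Notation abs := (padic_abs R p).
Local Notation act g z := (horner (map_poly (padic_of_rat R hp) g) z).

Let p1 : (1 < p)%N. Proof. exact: prime_gt1. Qed.
Let p1R : (1 : R) < p%:R. Proof. by rewrite ltr1n. Qed.
Let p0R : (0 : R) < p%:R. Proof. by rewrite ltr0n ltnW. Qed.

Lemma padic_abs_expn n : abs (p%:R ^+ n) = p%:R ^- n.
Proof.
have np0 : (p ^ n)%N != 0 by rewrite -lt0n expn_gt0 prime_gt0.
rewrite /padic_abs -natrX pnatr_eq0 (negPf np0) -[(p ^ n)%:R]/((p ^ n)%:Z%:~R).
rewrite /padic_val numq_int denq_int logn1 subr0 absz_nat pfactorK//.
by rewrite -invr_expz.
Qed.

(** An integer that is p-adically at most [p^-n] is divisible by [p^n]. *)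
Lemma padic_abs_intN_dvd (n : nat) (t : int) : abs t%:~R <= p%:R ^- n ->
  ((p ^ n)%:Z %| t)%Z.
Proof.
have [->|t0] := eqVneq t 0; first by rewrite dvdz0.
rewrite /padic_abs intr_eq0 (negPf t0) /padic_val numq_int denq_int logn1 subr0.
rewrite -invr_expz -exprnP lef_pV2 ?posrE ?exprn_gt0// ler_eXn2l// => nl.
by rewrite dvdzE absz_nat pfactor_dvdn// absz_gt0.
Qed.

Lemma padic_dist_ultra_disc (c y z : padic R hp) (r : R) :
  padic_disc c r y -> padic_disc c r z -> padic_norm (y - z) <= r.
Proof.
rewrite /padic_disc /= => cy cz.
apply: le_trans (padic_dist_ultra c y z) _.
by rewrite ge_max cy /= padic_dist_sym.
Qed.

Lemma covering_number_ge0 r (S : set (padic R hp)) : (0 <= covering_number r S)%E.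
Proof. by apply: le_ereal_inf_tmp => _ [n _ <-]; rewrite lee_fin. Qed.

Lemma padic_norm_continuous (z : padic R hp) :
  continuous (fun y : padic R hp => padic_norm (y - z) : R).
Proof.
move=> y; apply/(@cvgrPdist_lt _ _ _ _ (nbhs_filter y)) => e e0; near=> y'.
have yy' : padic_norm (y - y') < e.
  by have : ball y e y'; [near: y'; exact: nbhsx_ballx | rewrite padic_ballE].
apply: le_lt_trans yy'.
have t1 := padic_dist_triangle y' y z; have t2 := padic_dist_triangle y y' z.
have s := padic_dist_sym y' y.
by move: t1 t2 s; rewrite /padic_dist ler_norml; lra.
Unshelve. all: by end_near.
Qed.

Lemma compact_padic_bounded (K : set (padic R hp)) (z : padic R hp) :
  compact K -> exists C : R, forall y, K y -> padic_norm (y - z) <= C.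
Proof.
move=> cK.
have cI : compact ((fun y : padic R hp => padic_norm (y - z) : R) @` K).
  apply: continuous_compact => //; apply: continuous_subspaceT.
  exact: padic_norm_continuous.
have [C [_ HC]] := compact_bounded cI.
exists (C + 1) => y Ky.
have := HC (C + 1); rewrite ltrDl ltr01 => /(_ isT (padic_norm (y - z))).
by move=> H; rewrite (le_trans (ler_norm _))// H//; exists y.
Qed.

Variables (m : nat) (m_gt0 : (0 < m)%N).
Variables (a : 'I_m -> bool) (k : 'I_m -> nat) (b : 'I_m -> rat).
Hypothesis k_gt0 : forall i, (0 < k i)%N.

Local Notation f := (power_ifs p a k b).
Local Notation maps := (maps p a k b).
Local Notation nmaps := (nmaps p a k b).
Local Notation nid_maps := (nid_maps p a k b).
Local Notation word_map := (word_map p a k b).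
Local Notation slope := (slope p a k).
Local Notation trans := (trans p a k b).
Local Notation level := (level k).

Lemma act_word_map w z : act (word_map w) z = inQp (slope w) * z + inQp (trans w).
Proof.
rewrite word_mapE -mul_polyC rmorphD rmorphM /= !map_polyC map_polyX.
by rewrite hornerD hornerM hornerX !hornerC.
Qed.

Lemma act_word_map_cat u v z :
  act (word_map (u ++ v)) z = act (word_map u) (act (word_map v) z).
Proof. by rewrite word_map_cat map_comp_poly horner_comp. Qed.

Lemma padic_norm_slope w : padic_norm (inQp (slope w)) = p%:R ^- level w.
Proof.
rewrite padic_norm_of_rat /slope padic_absM// padic_abs_expn.
by case: (orient a w); rewrite ?expr1 ?padic_absN padic_abs1 mul1r.
Qed.

Lemma padic_norm_act u z z' :
  padic_norm (act (word_map u) z - act (word_map u) z') =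
  p%:R ^- level u * padic_norm (z - z').
Proof.
rewrite !act_word_map opprD addrACA subrr addr0 -mulrBr padic_normM.
by rewrite padic_norm_slope.
Qed.

Variable L : R.
Hypothesis HL : ln (nmaps n)%:R / n%:R @[n --> \oo] --> L.
Let M0 n : (0 < nmaps n)%N. Proof. exact: nmaps_gt0. Qed.

Variables (S : set (padic R hp)) (z : padic R hp).

(** If [S] contains the images of [z] by the semigroup, then for small [r] at least
[nmaps n / (c * (n + 1))] discs of radius [r] are needed to cover it, where
[p^n <= 1 / r < p^(n+1)]. *)
Lemma covering_number_ge : (forall w, w <> [::] -> S (act (word_map w) z)) ->
  exists2 c, (0 < c)%N & \forall r \near (0 : R)^'+,
  ((lower_count p nmaps c r^-1)%:E <= covering_number r S)%E.
Proof.
move=> Sz; have [D D0 [_ Db]] := common_denominator b 0.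
(* [|D * trans w| <= J * p^(level w)] *)
pose J := (D * (Num.truncn (bsum b)).+1)%N.
exists (4 * (2 * J).+1)%N => //; near=> r.
have r0 : 0 < r by near: r; exact: nbhs_right_gt.
have r1 : 1 < r^-1 by rewrite invf_gt1//; near: r; exact: nbhs_right_lt.
rewrite /lower_count; set n := scale p r^-1.
have rn : r <= p%:R ^- n.
  have /andP[ph _] := scale_itv p1 (ltW r1).
  by rewrite -[r]invrK lef_pV2 ?posrE ?exprn_gt0 ?invr_gt0.
have M2 : (nmaps n <= 2 * size (nid_maps n))%N.
  rewrite /n; near: r.
  have cs := cvg_comp _ _ (@cvg_invr_at_right0 R) (@cvg_scale R p p1).
  exact: (cs _ (nmaps_le2nid hp a b k_gt0 m_gt0)).
apply: le_ereal_inf_tmp => _ [N [cs Ncs] <-].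
rewrite lee_fin ler_pdivrMr ?ltr0n// -natrM ler_nat.
(* The index of a disc containing [g(z)]; [None] is a default value outside the
   maps under consideration. *)
have /choice[idx idxP] (g : {poly rat}) : exists i : option 'I_N,
    g \in nid_maps n -> exists2 j, i = Some j & padic_disc (cs j) r (act g z).
  have [gn|_] := boolP (g \in nid_maps n); last by exists None.
  have /(nid_mapsP hp _ _ k_gt0)[w [w0 wn gE]] := gn.
  have [j _ jw] := Ncs _ (Sz _ w0).
  by exists (Some j) => _; exists j; rewrite ?gE.
have DT (w : seq 'I_m) : D%:R * trans w \is a Num.int.
  by apply: int_word_map => //; rewrite mulr0.
(* The quotient by [p^n] of the integer [D * trans w]. *)
pose quo (g : {poly rat}) : int := (Num.floor (D%:R * g`_0) %/ (p ^ n)%:Z)%Z.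
pose qs : seq int := [seq j%:Z - J%:Z | j <- iota 0 (2 * J).+1].
(* A map is determined by the disc containing the image of [z], its slope and
   the quotient above. *)
pose key (g : {poly rat}) := (idx g, (g`_1, quo g)).
have sz : (size (nid_maps n) <= N * (2 * n.+1 * (2 * J).+1))%N.
  have -> : (N * (2 * n.+1 * (2 * J).+1))%N = size (allpairs pair
     [seq Some i | i <- enum 'I_N] (allpairs pair (slopes p n) qs)).
    by rewrite 2!size_allpairs size_slopes size_map size_enum_ord size_map size_iota.
  rewrite -(size_map key); apply: uniq_leq_size => [|_ /mapP[g gn ->]].
    rewrite map_inj_in_uniq ?filter_uniq ?uniq_maps// => g g' gn gn' [e1 e2 e3].
    have [j e4 gj] := idxP _ gn; have [j' e5 gj'] := idxP _ gn'.
    have jj' : j = j' by move: e1; rewrite e4 e5 => -[].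
    move: (gn) (gn') => /(nid_mapsP hp _ _ k_gt0)[u [_ _ gE]].
    move=> /(nid_mapsP hp _ _ k_gt0)[v [_ _ gE']].
    have su : slope u = slope v by move: e2; rewrite gE gE' !coef1_word_map.
    have uv : abs (trans u - trans v) <= p%:R ^- n.
      have := padic_dist_ultra_disc gj; rewrite jj' => /(_ _ gj').
      rewrite gE gE' !act_word_map su opprD addrACA subrr add0r -rmorphB.
      by rewrite padic_norm_of_rat => /le_trans; apply.
    move: e3; rewrite /quo gE gE' !coef0_word_map.
    have /intrP[U UE] := DT u; have /intrP[V VE] := DT v.
    rewrite UE VE !intrKfloor => UV.
    have dUV : ((p ^ n)%:Z %| U - V)%Z.
      apply: padic_abs_intN_dvd; rewrite intrB -UE -VE -mulrBr padic_absM//.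
      rewrite -[leRHS]mul1r ler_pM ?padic_abs_ge0//.
      exact: (padic_abs_intle1 R hp D%:Z).
    have UV0 : U = V.
      move: dUV; rewrite -eqz_mod_dvd => /eqP UVm.
      by rewrite (divz_eq U (p ^ n)%:Z) (divz_eq V (p ^ n)%:Z) UV UVm.
    have tt : trans u = trans v.
      apply: (@mulfI _ D%:R); first by rewrite pnatr_eq0 -lt0n.
      by rewrite UE VE UV0.
    by rewrite !word_mapE su tt.
  have [j e4 gj] := idxP _ gn.
  move: (gn) => /(nid_mapsP hp _ _ k_gt0)[w [_ wn gE]].
  apply: allpairs_f; first by rewrite e4 map_f// mem_enum.
  apply: allpairs_f; first by rewrite gE coef1_word_map mem_slopes.
  rewrite /quo gE coef0_word_map; have /intrP[U UE] := DT w.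
  rewrite UE intrKfloor; set P := (p ^ n)%:Z.
  have P0 : 0 < P by rewrite ltz_nat expn_gt0 prime_gt0.
  have UJ : `|U| <= J%:Z * P.
    rewrite -(ler_int rat) intr_norm -UE normrM ger0_norm ?ler0n//.
    rewrite /J /P PoszM !intrM -!pmulrn natrX -mulrA ler_wpM2l ?ler0n//.
    apply: le_trans (normr_trans hp a b k_gt0 w) _.
    apply: ler_pM; rewrite ?sumr_ge0 ?exprn_ge0 ?ler0n//.
      exact: (ltW (truncnS_gt _)).
    by rewrite ler_eXn2l ?ltr1n.
  have q1 : - J%:Z <= (U %/ P)%Z by rewrite lez_divRL//; move: UJ; lia.
  have q2 : (U %/ P)%Z < J%:Z + 1 by rewrite ltz_divLR//; move: UJ; nia.
  apply/mapP; exists `|((U %/ P)%Z + J%:Z)%R|%N; first by rewrite mem_iota; lia.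
  by lia.
have -> : (N * (4 * (2 * J).+1 * n.+1) =
  2 * (N * (2 * n.+1 * (2 * J).+1)))%N by lia.
by rewrite (leq_trans M2)// leq_mul2l sz.
Unshelve. all: by end_near.
Qed.

(** If every point of [S] is approximated by images of [z] as stated, then
[c * nmaps n] discs of radius [r] suffice to cover it, centred at images of [z],
where [p^n <= 1 / r < p^(n+1)]. *)
Lemma covering_number_le (C : R) :
  (forall y N, S y -> exists2 u, (level u <= N + kmax k)%N &
    padic_norm (y - act (word_map u) z) <= C * p%:R ^- N) ->
  exists2 c, (0 < c)%N & forall r, 0 < r -> r < 1 ->
  (covering_number r S <= (upper_count p nmaps c r^-1)%:E)%E.
Proof.
move=> SC.
have [s Cs] := exists_expn_ge C p1.
have [c c0 Mc] := nmaps_shift hp a b k_gt0 (1 + s + kmax k).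
exists c => // r r0 r1; have h1 : 1 < r^-1 by rewrite invf_gt1.
rewrite /upper_count; set n := scale p r^-1.
apply: (@le_trans _ _ (nmaps (n + (1 + s + kmax k)))%:R%:E); last first.
  by rewrite lee_fin ler_nat.
apply: ereal_inf_lbound; exists (nmaps (n + (1 + s + kmax k))) => //=.
set N' := (_ + (_ + _))%N.
exists (fun i => act (nth 0 (maps N') i) z) => y Sy.
have [u un yu] := SC y (n + 1 + s)%N Sy.
have um : word_map u \in maps N'.
  by apply/(mapsP p a b k_gt0); exists u; rewrite // /N' addnA addnA.
have iu : (index (word_map u) (maps N') < nmaps N')%N by rewrite index_mem.
exists (Ordinal iu) => //=; rewrite /padic_disc /= nth_index//.
apply: le_trans yu _.
have /andP[_ rn] := scale_itv p1 (ltW h1).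
have {}rn : p%:R ^- n.+1 <= r.
  by rewrite -[r]invrK lef_pV2 ?posrE ?exprn_gt0 ?invr_gt0// ltW.
apply: le_trans rn.
rewrite exprD addn1 invfM mulrCA ler_piMr ?invr_ge0 ?exprn_ge0//.
by rewrite ler_pdivrMr ?exprn_gt0// mul1r.
Qed.

Lemma has_padic_box_dim_of_near (C : R) :
  (forall w, w <> [::] -> S (act (word_map w) z)) ->
  (forall y N, S y -> exists2 u, (level u <= N + kmax k)%N &
    padic_norm (y - act (word_map u) z) <= C * p%:R ^- N) ->
  has_padic_box_dim S (L / ln p%:R)%:E.
Proof.
move=> /covering_number_ge[c c0 lo] /covering_number_le[c' c0' up].
have cv : box_rate S r @[r --> (0 : R)^'+] --> (L / ln p%:R)%:E.
  apply: (@cvg_log_count _ p nmaps L p1 M0 HL _ _ _ (fun r => r^-1) _ c c') => //.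
    exact: cvg_invr_at_right0.
  near=> r.
  have r0 : 0 < r by near: r; exact: nbhs_right_gt.
  have r1 : r < 1 by near: r; exact: nbhs_right_lt.
  have h1 : 1 < r^-1 by rewrite invf_gt1.
  rewrite /box_rate -lnV ?posrE//; apply/andP; split.
    by apply: lne_ratio_ge => //; [exact: lower_count_gt0|near: r].
  apply: lne_ratio_le => //; first exact: upper_count_gt0.
    exact: covering_number_ge0.
  exact: up.
by split; [exact: cvg_limf_einf | exact: cvg_limf_esup].
Unshelve. all: by end_near.
Qed.

End PadicDimensions.

(** * The orbit and the attractor *)

Section Instances.
Variables (R : realType) (p : nat) (hp : prime p).
Variables (m : nat) (a : 'I_m -> bool) (k : 'I_m -> nat) (b : 'I_m -> rat).

Local Notation inQp := (padic_of_rat R hp).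
Local Notation f := (power_ifs p a k b).
Local Notation act g z := (horner (map_poly (padic_of_rat R hp) g) z).
Local Notation word_map := (word_map p a k b).
Local Notation level := (level k).

Let p1 : (1 < p)%N. Proof. exact: prime_gt1. Qed.

Lemma padic_orbit_sub x w : w <> [::] ->
  (inQp @` forward_orbit f x) (act (word_map w) (inQp x)).
Proof.
move=> w0; rewrite horner_map; exists (word_map w).[x] => //.
by exists (word_map w) => //; apply/ifs_semigroupP; exists w.
Qed.

(** The constant [C] is a bound of [|g(x) - x|] over the maps [g]: these rational
numbers have the common denominator [D]. *)
Lemma padic_orbit_near x : exists C : R, forall y N, (inQp @` forward_orbit f x) y ->
  exists2 u, (level u <= N + kmax k)%N &
    padic_norm (y - act (word_map u) (inQp x)) <= C * p%:R ^- N.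
Proof.
have [D D0 [Dx Db]] := common_denominator b x.
have D0q : D%:R != 0 :> rat by rewrite pnatr_eq0 -lt0n.
exists (padic_abs R p D%:R)^-1 => _ N [_ [_ /ifs_semigroupP[w [_ ->]] <-] <-].
have C0 : 0 <= (padic_abs R p D%:R)^-1 by rewrite invr_ge0 padic_abs_ge0.
have [wN|[u [v [-> /andP[Nu uN]]]]] := level_prefix k N w.
  exists w; first by rewrite (leq_trans wN)// leq_addr.
  rewrite horner_map subrr -(rmorph0 inQp) padic_norm_of_rat padic_abs0.
  by rewrite mulr_ge0// invr_ge0 exprn_ge0.
exists u => //; rewrite -horner_map act_word_map_cat padic_norm_act mulrC.
rewrite ler_pM ?invr_ge0 ?exprn_ge0 ?padic_norm_ge0//; last first.
  rewrite lef_pV2 ?posrE ?exprn_gt0 ?ltr0n ?prime_gt0//.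
  by rewrite ler_eXn2l// ltr1n.
rewrite horner_map -rmorphB padic_norm_of_rat.
have /intrP[t tE] : D%:R * ((word_map v).[x] - x) \is a Num.int.
  by rewrite mulrBr rpredB// int_word_map.
rewrite -[leRHS]mul1r ler_pdivlMr ?padic_abs_gt0// mulrC -padic_absM// tE.
exact: padic_abs_intle1.
Qed.

Variable K : set (padic R hp).
Hypothesis k_gt0 : forall i, (0 < k i)%N.
Hypothesis K_attractor : is_padic_attractor f K.

Lemma attractor_act w z : K z -> K (act (word_map w) z).
Proof.
case: K_attractor => _ _ KE Kz; elim: w => [|i w IH].
  by rewrite /= map_polyX hornerX.
rewrite -cat1s act_word_map_cat KE; exists i => //=.
by exists (act (word_map w) z) => //; rewrite /= comp_polyXr.
Qed.

(** Every point of the attractor is the image of a point of the attractor by a map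
of level close to [N]. *)
Lemma attractor_preimage y N : K y -> exists u y',
  [/\ K y', y = act (word_map u) y' & (N <= level u <= N + kmax k)%N].
Proof.
case: K_attractor => _ _ KE; elim: N => [|N IH] Ky.
  exists [::], y; split => //; last by rewrite level_nil.
  by rewrite /= map_polyX hornerX.
have [u [y' [Ky' yE /andP[Nu uN]]]] := IH Ky.
have [Nu'|uN'] := ltnP N (level u).
  by exists u, y'; split => //; rewrite Nu' addSn leqW.
have [i _ [y'' Ky'' y''E]] :
    (\bigcup_i ((fun z => act (f i) z) @` K)) y' by rewrite -KE.
exists (u ++ [:: i]), y''; split => //.
  by rewrite act_word_map_cat yE -y''E /= comp_polyXr.
have := k_gt0 i; have : (k i <= kmax k)%N by exact: leq_bigmax.
rewrite level_cat level_seq1; lia.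
Qed.

Lemma attractor_near z C : K z -> (forall y, K y -> padic_norm (y - z) <= C) ->
  forall y N, K y -> exists2 u, (level u <= N + kmax k)%N &
    padic_norm (y - act (word_map u) z) <= C * p%:R ^- N.
Proof.
move=> Kz KC y N Ky; have [u [y' [Ky' -> /andP[Nu uN]]]] := attractor_preimage N Ky.
exists u => //; rewrite padic_norm_act mulrC.
rewrite ler_pM ?invr_ge0 ?exprn_ge0 ?padic_norm_ge0 ?KC//.
rewrite lef_pV2 ?posrE ?exprn_gt0 ?ltr0n ?prime_gt0//.
by rewrite ler_eXn2l// ltr1n.
Qed.

End Instances.

Theorem theorem7p1 (R : realType) (p : nat) (hp : prime p)
    (m : nat) (m_gt0 : (0 < m)%N)
    (a : 'I_m -> bool) (k : 'I_m -> nat) (b : 'I_m -> rat)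
    (k_gt0 : forall i, (0 < k i)%N)
    (f_inj : injective (power_ifs p a k b))
    (K : set (padic R hp)) (K_attractor : is_padic_attractor (power_ifs p a k b) K) :
  let f := power_ifs p a k b in
  let d := growth_dim R f in
  [/\ cvg (growth_rate R f r @[r --> +oo]),
      has_padic_box_dim K d
    & forall x : rat,
        [/\ has_mass_dim ((@ratr R) @` forward_orbit f x) d,
            beurling_dim ((@ratr R) @` forward_orbit f x) = d
          & has_padic_box_dim (padic_of_rat R hp @` forward_orbit f x) d]].
Proof.
move=> f d.
have [L HL] := cvg_ln_nmaps R hp a b k_gt0.
have dE : d = (L / ln p%:R)%:E by exact: growth_dimE.
rewrite dE; split.
- by apply/cvg_ex; exists (L / ln p%:R)%:E; exact: cvg_growth_rate.
- have [[z Kz] cK _] := K_attractor.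
  have [C KC] := compact_padic_bounded z cK.
  apply: (has_padic_box_dim_of_near m_gt0 k_gt0 HL (z := z) (C := C)).
    by move=> w _; exact: attractor_act.
  exact: attractor_near.
move=> x; split.
- exact: has_mass_dim_orbit.
- exact: beurling_dim_orbit.
have [C HC] := padic_orbit_near R hp a k b x.
apply: (has_padic_box_dim_of_near m_gt0 k_gt0 HL (z := padic_of_rat R hp x) (C := C)).
  exact: padic_orbit_sub.
exact: HC.
Qed.
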